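(* Let $\mathcal{P}$ be a hereditary, connected-hereditary or rooted-hereditary graph property, and suppose that the io-restricted maximal $\mathcal{P}$-subgraphs problem can be solved in polynomial time (in the number of vertices of the input). Then (1) the maximal $\mathcal{P}$-subgraphs problem can be solved in incremental polynomial time, and (2) for every constant $k$, given a graph $G$, some $k$ graphs of $\mathcal{P}^m(G)$ can be returned in time polynomial in the number of vertices of $G$.
   Context: A graph is a triple $G=(V,E,r)$ with $V$ a finite set of vertices, $E\subseteq V\times V$ a set of (directed) edges, and a root $r\in V\cup\{\bot\}$. $G$ is rooted if $r\neq\bot$ and every vertex is reachable from $r$ by a directed path; $G$ is connected if its underlying undirected graph is connected. $H$ is an induced subgraph of $G$, written $H\subseteq_{\mathrm{IS}} G$, if $H$ is obtained from $G$ by deleting some vertices (and incident edges), and the root of $H$ equals the root of $G$ if that root is still a vertex of $H$, and is $\bot$ otherwise; $H\subset_{\mathrm{IS}}G$ means additionally $H\neq G$. $G-v$ is the induced subgraph on all vertices other than $v$. A graph property is a nonempty (possibly infinite) set $\mathcal{P}$ of graphs; throughout, membership in $\mathcal{P}$ is decidable in polynomial time. $\mathcal{P}$ is hereditary if closed under induced subgraphs; connected-hereditary if all its graphs are connected and every connected induced subgraph of a graph in $\mathcal{P}$ is in $\mathcal{P}$; rooted-hereditary if all its graphs are rooted and every rooted induced subgraph of a graph in $\mathcal{P}$ is in $\mathcal{P}$. A $\mathcal{P}$-subgraph of $G$ is an $H\subseteq_{\mathrm{IS}}G$ with $H\in\mathcal{P}$; it is maximal if no $\mathcal{P}$-subgraph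 $H'$ of $G$ has $H\subset_{\mathrm{IS}}H'$; $\mathcal{P}^m(G)$ is the set of maximal $\mathcal{P}$-subgraphs and $\mathcal{P}^m(G;v)$ those containing vertex $v$. $G$ almost satisfies $\mathcal{P}$ if $G-v\in\mathcal{P}$ for some vertex $v$. The maximal $\mathcal{P}$-subgraphs problem: given $G$, output $\mathcal{P}^m(G)$. The io-restricted version: given $G$ almost satisfying $\mathcal{P}$ and a vertex $v'$, output $\mathcal{P}^m(G;v')$. A problem is solvable in incremental polynomial time if, for every $k$, the $k$-th output (without repetitions) is produced within time polynomial in $n$ (number of vertices of the input) and $k$. *)

(* Defs.v *)
From HB Require Import structures.
From mathcomp Require Import all_boot all_order all_algebra finmap.

Set Implicit Arguments.
Unset Strict Implicit.
Unset Printing Implicit Defensive.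

Local Open Scope fset_scope.

(** * Graphs *)

(* A triple (V, E, r), where r = None stands for the absent root. Vertices are
   drawn from nat, used only as a countable supply of names. *)
Definition graph_wf (x : {fset nat} * {fset nat * nat} * option nat) : bool :=
  (x.1.2 `<=` x.1.1 `*` x.1.1) && (if x.2 is Some r then r \in x.1.1 else true).

Record graph := Graph {
  gdata : {fset nat} * {fset nat * nat} * option nat;
  gdata_wf : graph_wf gdata }.

HB.instance Definition _ := [isSub for gdata].
HB.instance Definition _ := [Equality of graph by <:].

Definition verts (G : graph) : {fset nat} := (gdata G).1.1.
Definition edges (G : graph) : {fset nat * nat} := (gdata G).1.2.
Definition groot (G : graph) : option nat := (gdata G).2.

Definition nverts (G : graph) : nat := #|` verts G|.

Definition edge (G : graph) : rel nat := fun u v => (u, v) \in edges G.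

Definition uedge (G : graph) : rel nat := fun u v => edge G u v || edge G v u.

Definition reachable (e : rel nat) (u v : nat) : Prop :=
  exists2 p : seq nat, path e u p & last u p = v.

(* The graph without vertices counts as connected. *)
Definition connected (G : graph) : Prop :=
  forall u v, u \in verts G -> v \in verts G -> reachable (uedge G) u v.

Definition rooted (G : graph) : Prop :=
  exists2 r, groot G = Some r &
    forall v, v \in verts G -> reachable (edge G) r v.

Definition del_data (G : graph) (D : {fset nat}) :
    {fset nat} * {fset nat * nat} * option nat :=
  (verts G `\` D,
   [fset e in edges G | (e.1 \notin D) && (e.2 \notin D)],
   if groot G is Some r then if r \in D then None else Some r else None).

Lemma del_data_wf (G : graph) (D : {fset nat}) : graph_wf (del_data G D).
Proof.
have /andP[sE rV] := gdata_wf G; apply/andP; split=> /=.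
  apply/fsubsetP=> -[u v]; rewrite !inE /= => /andP[uvE /andP[uD vD]].
  have := fsubsetP sE _ uvE; rewrite !inE /= => /andP[uV vV].
  by rewrite uD vD; apply/andP.
rewrite /groot; case: (gdata G).2 rV => //= r rV.
by case: ifPn => // rD; rewrite inE rD.
Qed.

Definition del (G : graph) (D : {fset nat}) : graph := Graph (del_data_wf G D).

Definition del_vertex (G : graph) (v : nat) : graph := del G [fset v].

Definition isub (H G : graph) : Prop := exists D : {fset nat}, H = del G D.

Definition isub_strict (H G : graph) : Prop := isub H G /\ H <> G.

Local Close Scope fset_scope.

(** * Graph properties *)

Definition hereditary (P : graph -> Prop) : Prop :=
  forall G H, P G -> isub H G -> P H.

Definition connected_hereditary (P : graph -> Prop) : Prop :=
  (forall G, P G -> connected G) /\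
  (forall G H, P G -> isub H G -> connected H -> P H).

Definition rooted_hereditary (P : graph -> Prop) : Prop :=
  (forall G, P G -> rooted G) /\
  (forall G H, P G -> isub H G -> rooted H -> P H).

Definition psubgraph (P : graph -> Prop) (G H : graph) : Prop :=
  isub H G /\ P H.

Definition max_psubgraph (P : graph -> Prop) (G H : graph) : Prop :=
  psubgraph P G H /\ forall H', psubgraph P G H' -> ~ isub_strict H H'.

Definition max_psubgraph_at (P : graph -> Prop) (G : graph) (v : nat)
    (H : graph) : Prop :=
  max_psubgraph P G H /\ v \in verts H.

Definition almost_satisfies (P : graph -> Prop) (G : graph) : Prop :=
  exists2 v, v \in verts G & P (del_vertex G v).

(** * Model of computation *)

(* Programs are those of N. D. Jones' language WHILE ("Computability and
   Complexity from a Programming Perspective"), extended with non-recursive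
   procedure calls and an output instruction. Data are binary trees; vertex
   names are opaque leaves, which can be copied and tested for equality. Since
   trees can be stored with sharing and equality is tested on leaves only, every
   operation is a constant number of pointer operations, and polynomial time in
   this model is polynomial time on Turing machines. *)
Inductive tree := Nil | Atom of nat | Cons of tree & tree.

Inductive expr :=
| EVar of nat
| ENil
| EAtom of nat
| ECons of expr & expr
| EHd of expr
| ETl of expr
| EEq of expr & expr.

Inductive cmd :=
| Skip
| Assign of nat & expr
| Emit of expr
| Seq of cmd & cmd
| If of expr & cmd & cmd
| While of expr & cmd
| Call of nat & cmd & expr. (* Call x c e : x := c(e) *)

Definition tbool (b : bool) : tree := if b then Cons Nil Nil else Nil.

Definition ttrue (t : tree) : bool := if t is Nil then false else true.

Definition thd (t : tree) : tree := if t is Cons a _ then a else Nil.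

Definition ttl (t : tree) : tree := if t is Cons _ b then b else Nil.

Definition atom_eq (s t : tree) : bool :=
  match s, t with Atom i, Atom j => i == j | _, _ => false end.

Definition store := nat -> tree.

Definition upd (s : store) (x : nat) (t : tree) : store :=
  fun y => if y == x then t else s y.

Definition init (t : tree) : store := upd (fun=> Nil) 0 t.

Fixpoint eval (s : store) (e : expr) : tree :=
  match e with
  | EVar x => s x
  | ENil => Nil
  | EAtom i => Atom i
  | ECons e1 e2 => Cons (eval s e1) (eval s e2)
  | EHd e1 => thd (eval s e1)
  | ETl e1 => ttl (eval s e1)
  | EEq e1 e2 => tbool (atom_eq (eval s e1) (eval s e2))
  end.

Fixpoint ecost (e : expr) : nat :=
  match e with
  | EVar _ | ENil | EAtom _ => 1
  | ECons e1 e2 | EEq e1 e2 => (ecost e1 + ecost e2).+1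
  | EHd e1 | ETl e1 => (ecost e1).+1
  end.

(* Emitted trees, in order, each with the time at which it was emitted. *)
Definition trace := seq (nat * tree).

Definition delay (d : nat) (o : trace) : trace :=
  [seq (d + x.1, x.2) | x <- o].

(* exec c s t o s' : started in store s, the command c halts in store s' after
   exactly t steps, having emitted o; times in o are counted from the start of
   c. A called procedure runs in a store of its own; it receives its argument
   and returns its result in variable 0. *)
Inductive exec : cmd -> store -> nat -> trace -> store -> Prop :=
| exec_skip s : exec Skip s 1 [::] s
| exec_assign x e s :
    exec (Assign x e) s (ecost e).+1 [::] (upd s x (eval s e))
| exec_emit e s :
    exec (Emit e) s (ecost e).+1 [:: ((ecost e).+1, eval s e)] s
| exec_seq c1 c2 s1 s2 s3 t1 t2 o1 o2 :
    exec c1 s1 t1 o1 s2 -> exec c2 s2 t2 o2 s3 ->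
    exec (Seq c1 c2) s1 (t1 + t2) (o1 ++ delay t1 o2) s3
| exec_if e c1 c2 s s' t o :
    exec (if ttrue (eval s e) then c1 else c2) s t o s' ->
    exec (If e c1 c2) s ((ecost e).+1 + t) (delay (ecost e).+1 o) s'
| exec_while_false e c s :
    ~~ ttrue (eval s e) -> exec (While e c) s (ecost e).+1 [::] s
| exec_while_true e c s s' t o :
    ttrue (eval s e) -> exec (Seq c (While e c)) s t o s' ->
    exec (While e c) s ((ecost e).+1 + t) (delay (ecost e).+1 o) s'
| exec_call x c e s s' t o :
    exec c (init (eval s e)) t o s' ->
    exec (Call x c e) s ((ecost e).+1 + t) (delay (ecost e).+1 o)
      (upd s x (s' 0)).

Definition returns (c : cmd) (input result : tree) (t : nat) : Prop :=
  exists2 s, exec c (init input) t [::] s & s 0 = result.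

(** * Encodings *)

Definition tlist (l : seq tree) : tree := foldr Cons Nil l.

Definition vseq (G : graph) : seq nat := sort leq (verts G).

Definition eseq (G : graph) : seq (nat * nat) :=
  [seq e <- [seq (u, v) | u <- vseq G, v <- vseq G] | e \in edges G].

Definition tgraph (G : graph) : tree :=
  Cons (tlist [seq Atom v | v <- vseq G])
    (Cons (tlist [seq Cons (Atom e.1) (Atom e.2) | e <- eseq G])
       (if groot G is Some r then Atom r else Nil)).

Definition tgraphs (Hs : seq graph) : tree := tlist [seq tgraph H | H <- Hs].

Definition lists (Hs : seq graph) (A : graph -> Prop) : Prop :=
  uniq Hs /\ forall H, H \in Hs <-> A H.

(** * Computational problems *)

Definition poly_decidable (P : graph -> Prop) : Prop :=
  exists (c : cmd) (p : {poly nat}), forall G,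
  exists (b : bool) (t : nat),
    [/\ returns c (tgraph G) (tbool b) t,
        t <= p.[nverts G]%R
      & b <-> P G].

Definition io_restricted_poly_solvable (P : graph -> Prop) : Prop :=
  exists (c : cmd) (p : {poly nat}), forall G v,
  almost_satisfies P G -> v \in verts G ->
  exists (Hs : seq graph) (t : nat),
    [/\ returns c (Cons (tgraph G) (Atom v)) (tgraphs Hs) t,
        t <= p.[nverts G]%R
      & lists Hs (max_psubgraph_at P G v)].

(* Outputs are numbered from k = 0. For k at least the number of outputs, the
   default value t of nth makes the last clause bound the halting time: by then
   it is known that there is no k-th output. A polynomial in n + k with natural
   coefficients dominates any given polynomial in n and k. *)
Definition incremental_poly_solvable (P : graph -> Prop) : Prop :=
  exists (c : cmd) (p : {poly nat}), forall G,
  exists (Hs : seq graph) (t : nat) (o : trace) (s : store),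
    [/\ exec c (init (tgraph G)) t o s,
        [seq x.2 | x <- o] = [seq tgraph H | H <- Hs],
        lists Hs (max_psubgraph P G)
      & forall k, nth t [seq x.1 | x <- o] k <= p.[(nverts G + k.+1)%N]%R].

(* If G has fewer than k maximal P-subgraphs, all of them are returned. *)
Definition k_max_psubgraphs_poly (P : graph -> Prop) (k : nat) : Prop :=
  exists (c : cmd) (p : {poly nat}), forall G,
  exists (Hs : seq graph) (t : nat),
    [/\ returns c (tgraph G) (tgraphs Hs) t,
        t <= p.[nverts G]%R,
        uniq Hs,
        forall H, H \in Hs -> max_psubgraph P G H
      & size Hs = k \/ size Hs < k /\ lists Hs (max_psubgraph P G)].

(* Main.v *)
(* For a fixed graph the vertex sets of its P-subgraphs form a strongly
   accessible family: whenever X is a proper subset of Y and both belong to it,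
   some vertex of Y can be added to X. Hence a P-subgraph is extended greedily
   to a maximal one. Let N be a list of maximal P-subgraphs and Y a maximal
   P-subgraph. Starting from a seed (the empty graph or the root alone), grow a
   member C of the family inside Y and inside some X of N, one vertex v of Y at
   a time. If v is not in X, then C + v lies in some maximal P-subgraph of
   G[X + v] containing v, which the io-restricted problem lists; its greedy
   extension replaces X. Thus either N is complete, or one of these extensions
   is a new maximal P-subgraph; finding it takes time polynomial in n and |N|,
   because a program running in polynomial time returns a list of polynomial
   length. Iterating this search gives both claims. *)

From mathcomp Require Import all_boot all_order all_algebra finmap zify.
From Stdlib Require Import ClassicalEpsilon.
Require Import Defs.

Set Implicit Arguments.
Unset Strict Implicit.
Unset Printing Implicit Defensive.

Import GRing.Theory.

(** The intersection of two [P]-subgraphs [X] and [Y] need not satisfy a connected- or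
    rooted-hereditary property, so it cannot measure how close [X] is to [Y]. The common member [C]
    takes its place. It occurs in the correctness proof only: a program does not know [Y], so it
    exchanges every [X] of [N] at every vertex of the graph. On the side of programs, the
    io-restricted problem comes with a promise, and running times are measured in vertices and not
    in the size of trees. Computability is therefore stated relative to a domain of indices and a
    size function on them; every loop has to carry the promise and a bound on the size of its
    accumulator along. *)

Lemma leq_horner (p : {poly nat}) m n : m <= n -> p.[m]%R <= p.[n]%R.
Proof.
move=> le_mn; rewrite !horner_coef; apply: leq_sum => i _.
apply: leq_mul => //; elim: (nat_of_ord i) => [|k IH]; first by rewrite !expr0.
by rewrite !exprS; apply: leq_mul.
Qed.

(** * Silent executions *)

Lemma run_seq c1 c2 s1 s2 s3 t1 t2 :
  exec c1 s1 t1 [::] s2 -> exec c2 s2 t2 [::] s3 ->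
  exec (Seq c1 c2) s1 (t1 + t2) [::] s3.
Proof. exact: exec_seq. Qed.

Lemma run_call x c e s r t :
  returns c (eval s e) r t ->
  exec (Call x c e) s ((ecost e).+1 + t) [::] (upd s x r).
Proof. by case=> s' E <-; apply: (exec_call _ E). Qed.

Lemma run_if e c1 c2 s s' t :
  exec (if ttrue (eval s e) then c1 else c2) s t [::] s' ->
  exec (If e c1 c2) s ((ecost e).+1 + t) [::] s'.
Proof. exact: exec_if. Qed.

Lemma run_while e c s s1 s2 t1 t2 :
  ttrue (eval s e) -> exec c s t1 [::] s1 -> exec (While e c) s1 t2 [::] s2 ->
  exec (While e c) s ((ecost e).+1 + (t1 + t2)) [::] s2.
Proof.
by move=> se E1 E2; apply: (exec_while_true se (run_seq E1 E2)).
Qed.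

(** * Functions computable in polynomial time *)

Section Computable.

Variables (I : Type) (D : I -> Prop) (sz : I -> nat).

Definition pbounded (f : I -> nat) : Prop :=
  exists p : {poly nat}, forall i, D i -> f i <= p.[sz i]%R.

Lemma pbounded_le f g :
  (forall i, D i -> f i <= g i) -> pbounded g -> pbounded f.
Proof.
by move=> fg [p gp]; exists p => i Di; apply: leq_trans (fg i Di) (gp i Di).
Qed.

Lemma pbounded_sz : pbounded sz.
Proof. by exists 'X%R => i _; rewrite hornerX. Qed.

Lemma pbounded_const c : pbounded (fun=> c).
Proof. by exists (c%:P)%R => i _; rewrite hornerC. Qed.

Lemma pboundedD f g : pbounded f -> pbounded g -> pbounded (fun i => f i + g i).
Proof.
move=> [p fp] [q gq]; exists (p + q)%R => i Di; rewrite hornerD.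
by apply: leq_add; [apply: fp | apply: gq].
Qed.

Lemma pboundedM f g : pbounded f -> pbounded g -> pbounded (fun i => f i * g i).
Proof.
move=> [p fp] [q gq]; exists (p * q)%R => i Di; rewrite hornerM.
by apply: leq_mul; [apply: fp | apply: gq].
Qed.

Lemma pbounded_horner (p : {poly nat}) f :
  pbounded f -> pbounded (fun i => p.[f i]%R).
Proof.
move=> [q fq]; exists (p \Po q)%R => i Di; rewrite horner_comp.
by apply: leq_horner; apply: fq.
Qed.

(** An index [i] is the mathematical input, [x i] and [y i] are the encodings of input and output.
    [D] is a promise: outside it the program may do anything, even diverge. *)
Definition pcomp (x y : I -> tree) : Prop :=
  exists (c : cmd) (p : {poly nat}), forall i, D i ->
  exists2 t, returns c (x i) (y i) t & t <= p.[sz i]%R.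

Lemma pcomp_bounded c x y (f : I -> nat) : pbounded f ->
  (forall i, D i -> exists2 t, returns c (x i) (y i) t & t <= f i) ->
  pcomp x y.
Proof.
move=> [p fp] Hc; exists c, p => i Di; have [t ct tf] := Hc i Di.
by exists t => //; apply: leq_trans tf (fp i Di).
Qed.

Lemma pcomp_eqr x y z :
  (forall i, D i -> y i = z i) -> pcomp x y -> pcomp x z.
Proof.
move=> yz [c [p Hc]]; exists c, p => i Di; rewrite -yz //; exact: Hc.
Qed.

Lemma pcomp_expr e x y :
  (forall i, D i -> eval (init (x i)) e = y i) -> pcomp x y.
Proof.
move=> xy; apply: (@pcomp_bounded (Assign 0 e) _ _ (fun=> (ecost e).+1)).
  exact: pbounded_const.
by move=> i Di; exists (ecost e).+1 => //; rewrite -xy //; eexists; first constructor.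
Qed.

Lemma pcomp_comp y x z : pcomp x y -> pcomp y z -> pcomp x z.
Proof.
move=> [c1 [p1 H1]] [c2 [p2 H2]].
apply: (@pcomp_bounded (Seq (Call 0 c1 (EVar 0)) (Call 0 c2 (EVar 0))) _ _
  (fun i => (p1.[sz i] + p2.[sz i])%R + 4)).
  by apply: pboundedD (pbounded_const _); apply: pboundedD;
     apply/pbounded_horner/pbounded_sz.
move=> i Di; have [t1 R1 B1] := H1 i Di; have [t2 R2 B2] := H2 i Di.
eexists; first eexists.
- apply: run_seq; first exact: (run_call _ (e := EVar 0) R1).
  exact: (run_call _ (e := EVar 0) R2).
- by [].
(* The sum of polynomial values is a ring sum; [lia] has to see it as addition of natural
   numbers. *)
- rewrite /=; rewrite -[(_ + _)%R]/(_ + _)%N; lia.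
Qed.

Lemma pcomp_pair x y z :
  pcomp x y -> pcomp x z -> pcomp x (fun i => Cons (y i) (z i)).
Proof.
move=> [c1 [p1 H1]] [c2 [p2 H2]].
apply: (@pcomp_bounded
  (Seq (Call 1 c1 (EVar 0)) (Seq (Call 2 c2 (EVar 0))
    (Assign 0 (ECons (EVar 1) (EVar 2))))) _ _
  (fun i => (p1.[sz i] + p2.[sz i])%R + 8)).
  by apply: pboundedD (pbounded_const _); apply: pboundedD;
     apply/pbounded_horner/pbounded_sz.
move=> i Di; have [t1 R1 B1] := H1 i Di; have [t2 R2 B2] := H2 i Di.
eexists; first eexists.
- apply: run_seq; first exact: (run_call _ (e := EVar 0) R1).
  apply: run_seq; first exact: (run_call _ (e := EVar 0) R2).
  exact: exec_assign.
- by [].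
- rewrite /=; rewrite -[(_ + _)%R]/(_ + _)%N; lia.
Qed.

Lemma pcomp_id x : pcomp x x.
Proof. exact: (@pcomp_expr (EVar 0)). Qed.

(** The input stays available beside the computed value, as under a local definition. *)
Lemma pcomp_let y x z :
  pcomp x y -> pcomp (fun i => Cons (x i) (y i)) z -> pcomp x z.
Proof. by move=> xy; apply: pcomp_comp (pcomp_pair (pcomp_id x) xy). Qed.

End Computable.

(** Each branch may use the outcome of the test as part of its promise; this is how the promise of
    the io-restricted problem is met later. *)
Lemma pcomp_if I D sz (x y c : I -> tree) :
  pcomp D sz x c ->
  pcomp (fun i => D i /\ ttrue (c i)) sz x y ->
  pcomp (fun i => D i /\ ~~ ttrue (c i)) sz x y ->
  pcomp D sz x y.
Proof.
move=> [c0 [p0 H0]] [c1 [p1 H1]] [c2 [p2 H2]].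
apply: (@pcomp_bounded _ _ _
  (Seq (Call 1 c0 (EVar 0))
     (If (EVar 1) (Call 0 c1 (EVar 0)) (Call 0 c2 (EVar 0)))) _ _
  (fun i => (p0.[sz i] + (p1.[sz i] + p2.[sz i]))%R + 8)).
  by apply: pboundedD (pbounded_const _ _ _); do 2?[apply: pboundedD];
     apply/pbounded_horner/pbounded_sz.
move=> i Di; have [t0 R0 B0] := H0 i Di.
have [t [s' E R] B]: exists2 t, (exists2 s', exec (if ttrue (c i) then
    Call 0 c1 (EVar 0) else Call 0 c2 (EVar 0)) (upd (init (x i)) 1 (c i))
      (2 + t) [::] s' & s' 0 = y i) & t <= p1.[sz i]%R + p2.[sz i]%R.
  case: ifPn => ci.
    have [t1 R1 B1] := H1 i (conj Di ci); exists t1; last by lia.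
    by eexists; first exact: (run_call _ (e := EVar 0) R1).
  have [t1 R1 B1] := H2 i (conj Di ci); exists t1; last by lia.
  by eexists; first exact: (run_call _ (e := EVar 0) R1).
exists ((2 + t0) + (2 + (2 + t))); last first.
  rewrite -[X in _ <= X]/(_ + (_ + _) + 8)%N; lia.
exists s' => //; apply: run_seq; first exact: (run_call _ (e := EVar 0) R0).
exact: (run_if (e := EVar 1)).
Qed.

Lemma pbounded_map J (E : J -> Prop) I (D : I -> Prop) (h : J -> I) sz f :
  (forall j, E j -> D (h j)) -> pbounded D sz f ->
  pbounded E (fun j => sz (h j)) (fun j => f (h j)).
Proof. by move=> ED [p fp]; exists p => j Ej; apply: fp; apply: ED. Qed.

(* Renaming of indices together with a rearrangement [e] of the input. *)
Lemma pcomp_call (J : Type) (E : J -> Prop) sz' (x' y' : J -> tree)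
    (I : Type) (D : I -> Prop) sz (e : expr) (h : I -> J) (x y : I -> tree) :
  pcomp E sz' x' y' ->
  (forall i, D i -> E (h i)) -> pbounded D sz (fun i => sz' (h i)) ->
  (forall i, D i -> eval (init (x i)) e = x' (h i)) ->
  (forall i, D i -> y i = y' (h i)) -> pcomp D sz x y.
Proof.
move=> [c [p Hc]] DE Dsz xe yy; apply: (@pcomp_comp _ _ _ (fun i => x' (h i))).
  exact: pcomp_expr xe.
apply: (@pcomp_bounded _ _ _ c _ _ (fun i => p.[sz' (h i)]%R)).
  exact: pbounded_horner.
by move=> i Di; rewrite yy //; apply: Hc; apply: DE.
Qed.

Lemma pcomp_tbool I D sz (x c : I -> tree) (b : I -> bool) :
  pcomp D sz x c -> (forall i, D i -> ttrue (c i) = b i) ->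
  pcomp D sz x (fun i => tbool (b i)).
Proof.
move=> xc cb; apply: (pcomp_if xc).
  by apply: (@pcomp_expr _ _ _ (ECons ENil ENil)) => i [Di]; rewrite cb // => ->.
by apply: (@pcomp_expr _ _ _ ENil) => i [Di]; rewrite cb // => /negbTE ->.
Qed.

Lemma ttrue_tbool b : ttrue (tbool b) = b. Proof. by case: b. Qed.

Lemma pcomp_not I D sz (x : I -> tree) (b : I -> bool) :
  pcomp D sz x (fun i => tbool (b i)) ->
  pcomp D sz x (fun i => tbool (~~ b i)).
Proof.
move=> xb; apply: (pcomp_if xb).
  by apply: (@pcomp_expr _ _ _ ENil) => i [_]; rewrite ttrue_tbool => ->.
apply: (@pcomp_expr _ _ _ (ECons ENil ENil)) => i [_].
by rewrite ttrue_tbool => /negbTE ->.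
Qed.

Lemma pcomp_subdom I (D E : I -> Prop) sz x y :
  (forall i, E i -> D i) -> pcomp D sz x y -> pcomp E sz x y.
Proof. by move=> ED [c [p H]]; exists c, p => i Ei; apply: H; apply: ED. Qed.

Lemma pcomp_and I D sz (x : I -> tree) (a b : I -> bool) :
  pcomp D sz x (fun i => tbool (a i)) ->
  pcomp D sz x (fun i => tbool (b i)) ->
  pcomp D sz x (fun i => tbool (a i && b i)).
Proof.
move=> xa xb; apply: (pcomp_if xa).
  apply: (@pcomp_eqr _ _ _ _ (fun i => tbool (b i))).
    by move=> i [_]; rewrite ttrue_tbool => ->.
  by apply: pcomp_subdom xb => i [].
apply: (@pcomp_expr _ _ _ ENil) => i [_].
by rewrite ttrue_tbool => /negbTE ->.
Qed.

(** * Iteration over lists *)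

(** Variable 1 holds the environment, 2 the accumulator and 3 the remaining list. *)
Definition fold_loop (c : cmd) : cmd :=
  While (EVar 3) (Seq
    (Call 2 c (ECons (EVar 1) (ECons (EVar 2) (EHd (EVar 3)))))
    (Assign 3 (ETl (EVar 3)))).

Definition fold_cmd (c : cmd) : cmd :=
  Seq (Assign 1 (EHd (EVar 0)))
 (Seq (Assign 2 (EHd (ETl (EVar 0))))
 (Seq (Assign 3 (ETl (ETl (EVar 0))))
 (Seq (fold_loop c) (Assign 0 (EVar 2))))).

Lemma exec_fold_loop (A : eqType) B (eA : A -> tree) (eB : B -> tree)
    (Inv : B -> Prop) (f : B -> A -> B) c env T (l : seq A) b s :
  (forall b a, Inv b -> a \in l -> Inv (f b a)) ->
  (forall b a, Inv b -> a \in l -> exists2 t,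
     returns c (Cons env (Cons (eB b) (eA a))) (eB (f b a)) t & t <= T) ->
  Inv b -> s 1 = env -> s 2 = eB b -> s 3 = tlist (map eA l) ->
  exists2 t, t <= size l * (T + 13) + 2 &
  exists2 s', exec (fold_loop c) s t [::] s' & s' 2 = eB (foldl f b l).
Proof.
elim: l b s => [|a l IH] b s fI fc Ib s1 s2 s3.
  exists 2 => //; exists s => //.
  by apply: (@exec_while_false (EVar 3)); rewrite /= s3.
have [t Rc tT] := fc b a Ib (mem_head _ _).
pose s4 := upd (upd s 2 (eB (f b a))) 3 (tlist (map eA l)).
have [|||t' Bt [s' E' R']] :=
  IH (f b a) s4 _ _ (fI _ _ Ib (mem_head _ _)) _ erefl erefl.
- by move=> b' a' Ib' la'; apply: fI => //; rewrite inE la' orbT.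
- by move=> b' a' Ib' la'; apply: fc => //; rewrite inE la' orbT.
- by rewrite /s4 /upd /=.
(* One round: 2 for the test, 7 for passing the argument of the call, 3 for dropping the head of the
   list. *)
exists (2 + ((7 + t + 3) + t')).
  by rewrite /= mulSn; lia.
exists s' => //.
apply: (@run_while (EVar 3)) E'; first by rewrite /= s3.
apply: (run_seq (s2 := upd s 2 (eB (f b a)))).
  apply: (@run_call _ _ (ECons (EVar 1) (ECons (EVar 2) (EHd (EVar 3))))).
  by rewrite /= s1 s2 s3.
have -> : s4 = upd (upd s 2 (eB (f b a))) 3
    (eval (upd s 2 (eB (f b a))) (ETl (EVar 3))) by rewrite /s4 /= /upd /= s3.
exact: exec_assign.
Qed.

(** The time of a round must be polynomial in the size of [i] alone, whatever the accumulator. [Inv]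
    makes this possible: it is the promise on accumulators, and it can bound their size. *)
Lemma pcomp_fold I (D : I -> Prop) sz (A : eqType) B (env : I -> tree)
    (eA : A -> tree) (eB : B -> tree) (Inv : I -> B -> Prop)
    (l : I -> seq A) (b0 : I -> B) (f : I -> B -> A -> B) :
  (forall i, D i -> Inv i (b0 i)) ->
  (forall i b a, D i -> Inv i b -> a \in l i -> Inv i (f i b a)) ->
  pbounded D sz (fun i => size (l i)) ->
  pcomp (fun j : I * B * A => [/\ D j.1.1, Inv j.1.1 j.1.2 & j.2 \in l j.1.1])
    (fun j => sz j.1.1)
    (fun j => Cons (env j.1.1) (Cons (eB j.1.2) (eA j.2)))
    (fun j => eB (f j.1.1 j.1.2 j.2)) ->
  pcomp D sz (fun i => Cons (env i) (Cons (eB (b0 i)) (tlist (map eA (l i)))))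
    (fun i => eB (foldl (f i) (b0 i) (l i))).
Proof.
move=> I0 If Bl [c [p Hc]].
apply: (@pcomp_bounded _ _ _ (fold_cmd c) _ _
  (fun i => size (l i) * (p.[sz i]%R + 13) + 20)).
  apply: pboundedD; last exact: pbounded_const.
  apply: pboundedM => //; apply: pboundedD; last exact: pbounded_const.
  exact/pbounded_horner/pbounded_sz.
move=> i Di; pose x := Cons (env i) (Cons (eB (b0 i)) (tlist (map eA (l i)))).
pose s1 := upd (init x) 1 (env i).
pose s2 := upd s1 2 (eB (b0 i)).
pose s3 := upd s2 3 (tlist (map eA (l i))).
have [||t Bt [s' E' R']] := @exec_fold_loop A B eA eB (Inv i) (f i) c (env i)
  p.[sz i]%R (l i) (b0 i) s3 _ _ (I0 i Di) erefl erefl erefl.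
- by move=> b a; apply: If.
- by move=> b a Ib la; apply: (Hc (i, b, a)).
exists (3 + (4 + (4 + (t + 2)))); last by lia.
eexists; last first.
- rewrite -R'; instantiate (1 := upd s' 0 (s' 2)); by rewrite /upd.
- apply: run_seq; first exact: (@exec_assign _ (EHd (EVar 0))).
  apply: run_seq; first exact: (@exec_assign _ (EHd (ETl (EVar 0)))).
  apply: run_seq; first exact: (@exec_assign _ (ETl (ETl (EVar 0)))).
  apply: run_seq; first exact: E'.
  exact: (@exec_assign _ (EVar 2)).
Qed.

Lemma foldl_catrev T (u v : seq T) : foldl (fun acc a => a :: acc) v u = catrev u v.
Proof. by elim: u v => //= a u IH v; rewrite IH. Qed.

(** The time depends on the first list only. This matters in [pcomp_flatmap], where the second list
    is an accumulator under the trivial invariant. *)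
Lemma pcomp_catrev (B : eqType) (eB : B -> tree) :
  pcomp (fun=> True) (fun uv : seq B * seq B => size uv.1)
    (fun uv => Cons (tlist (map eB uv.2)) (tlist (map eB uv.1)))
    (fun uv => tlist (map eB (catrev uv.1 uv.2))).
Proof.
apply: (@pcomp_comp _ _ _
  (fun uv => Cons Nil (Cons (tlist (map eB uv.2)) (tlist (map eB uv.1))))).
  by apply: (@pcomp_expr _ _ _ (ECons ENil (EVar 0))).
apply: (@pcomp_eqr _ _ _ _
    (fun uv => tlist (map eB (foldl (fun acc a => a :: acc) uv.2 uv.1)))).
  by move=> uv _; rewrite foldl_catrev.
apply: (@pcomp_fold _ _ _ _ _ (fun=> Nil) eB (fun v => tlist (map eB v))
  (fun _ _ => True) fst snd (fun _ acc a => a :: acc)) => //.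
  exact: pbounded_sz.
by apply: (@pcomp_expr _ _ _
  (ECons (ETl (ETl (EVar 0))) (EHd (ETl (EVar 0))))).
Qed.

Lemma size_flatten_le (T : eqType) U (g : T -> seq U) l n :
  (forall a, a \in l -> size (g a) <= n) ->
  size (flatten (map g l)) <= size l * n.
Proof.
elim: l => //= a l IH Hg; rewrite size_cat mulSn leq_add ?Hg ?mem_head //.
by apply: IH => b lb; apply: Hg; rewrite inE lb orbT.
Qed.

Lemma pcomp_flatmap I (D : I -> Prop) sz (A B : eqType) (env : I -> tree)
    (eA : A -> tree) (eB : B -> tree) (l : I -> seq A) (g : I -> A -> seq B) :
  pbounded D sz (fun i => size (l i)) ->
  pbounded (fun j : I * A => D j.1 /\ j.2 \in l j.1) (fun j => sz j.1)
    (fun j => size (g j.1 j.2)) ->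
  pcomp (fun j : I * A => D j.1 /\ j.2 \in l j.1) (fun j => sz j.1)
    (fun j => Cons (env j.1) (eA j.2))
    (fun j => tlist (map eB (g j.1 j.2))) ->
  pcomp D sz (fun i => Cons (env i) (tlist (map eA (l i))))
    (fun i => tlist (map eB (flatten (map (g i) (l i))))).
Proof.
move=> Bl [q gq] Hg.
(* Prepending makes a round independent of the length of the accumulator; one reversal at the end
   restores the order. *)
pose f i (acc : seq B) a := catrev (g i a) acc.
have fE i s acc : foldl (f i) acc s = catrev (flatten (map (g i) s)) acc.
  elim: s acc => //= a s IH acc; rewrite IH /f.
  by rewrite !catrevE rev_cat catA.
apply: (@pcomp_comp _ _ _ (fun i => tlist (map eB (foldl (f i) [::] (l i))))).
  apply: (@pcomp_comp _ _ _
    (fun i => Cons (env i) (Cons Nil (tlist (map eA (l i)))))).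
    by apply: (@pcomp_expr _ _ _
      (ECons (EHd (EVar 0)) (ECons ENil (ETl (EVar 0))))).
  apply: (@pcomp_fold _ _ _ _ _ env eA (fun v => tlist (map eB v))
    (fun _ _ => True) l (fun=> [::]) f) => //.
  apply: (@pcomp_let _ _ _ (fun j => tlist (map eB (g j.1.1 j.2)))).
    apply: (@pcomp_call _ _ _ _ _ _ _ _
      (ECons (EHd (EVar 0)) (ETl (ETl (EVar 0)))) (fun j => (j.1.1, j.2)) _ _ Hg).
    - by move=> j [].
    - exact: pbounded_sz.
    - by [].
    - by [].
  apply: (@pcomp_call _ _ _ _ _ _ _ _
    (ECons (EHd (ETl (EHd (EVar 0)))) (ETl (EVar 0)))
    (fun j => (g j.1.1 j.2, j.1.2)) _ _ (pcomp_catrev eB)) => //.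
  by exists q => -[[i b] a] [Di _ la] /=; apply: (gq (i, a)).
apply: (@pcomp_call _ _ _ _ _ _ _ _ (ECons ENil (EVar 0))
  (fun i => (foldl (f i) [::] (l i), [::])) _ _ (pcomp_catrev eB)) => //=.
  apply: (pbounded_le (g := fun i => size (l i) * q.[sz i]%R)).
    move=> i Di; rewrite fE catrevE cats0 size_rev.
    by apply: size_flatten_le => a la; apply: (gq (i, a)).
  by apply: pboundedM => //; apply/pbounded_horner/pbounded_sz.
by move=> i _; rewrite fE !catrevE !cats0 revK.
Qed.

(* Catenation is the flattening of a two-element list. *)
Lemma pcomp_cat I (D : I -> Prop) sz (A : eqType) (eA : A -> tree) x
    (l1 l2 : I -> seq A) :
  pbounded D sz (fun i => size (l1 i)) -> pbounded D sz (fun i => size (l2 i)) ->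
  pcomp D sz x (fun i => tlist (map eA (l1 i))) ->
  pcomp D sz x (fun i => tlist (map eA (l2 i))) ->
  pcomp D sz x (fun i => tlist (map eA (l1 i ++ l2 i))).
Proof.
move=> B1 B2 x1 x2.
apply: (@pcomp_comp _ _ _ (fun i => Cons Nil
  (tlist (map (fun l => tlist (map eA l)) [:: l1 i; l2 i])))).
  apply: pcomp_pair; first by apply: (@pcomp_expr _ _ _ ENil).
  by apply: pcomp_pair x1 _; apply: pcomp_pair x2 _; apply: (@pcomp_expr _ _ _ ENil).
apply: (@pcomp_eqr _ _ _ _ (fun i =>
  tlist (map eA (flatten (map id [:: l1 i; l2 i]))))).
  by move=> i _; rewrite /= cats0.
apply: (pcomp_flatmap (env := fun=> Nil) (l := fun i => [:: l1 i; l2 i])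
  (g := fun=> id)).
- exact: (pbounded_const _ _ 2).
- have [p Hp] := pboundedD B1 B2; exists p => -[i l] [Di] /=.
  have := Hp i Di; rewrite !inE => Hl /orP[] /eqP ->; lia.
- by apply: (@pcomp_expr _ _ _ (ETl (EVar 0))).
Qed.

Lemma pcomp_filter I (D : I -> Prop) sz (A : eqType) (env : I -> tree)
    (eA : A -> tree) (l : I -> seq A) (p : I -> A -> bool) :
  pbounded D sz (fun i => size (l i)) ->
  pcomp (fun j : I * A => D j.1 /\ j.2 \in l j.1) (fun j => sz j.1)
    (fun j => Cons (env j.1) (eA j.2)) (fun j => tbool (p j.1 j.2)) ->
  pcomp D sz (fun i => Cons (env i) (tlist (map eA (l i))))
    (fun i => tlist (map eA (filter (p i) (l i)))).
Proof.
move=> Bl Hp; pose g i a := if p i a then [:: a] else [::].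
have gE i s : flatten (map (g i) s) = filter (p i) s.
  by elim: s => //= a s ->; rewrite /g; case: (p i a).
apply: (@pcomp_eqr _ _ _ _ (fun i => tlist (map eA (flatten (map (g i) (l i)))))).
  by move=> i _; rewrite gE.
apply: pcomp_flatmap => //.
  apply: (pbounded_le (g := fun=> 1)); last exact: pbounded_const.
  by move=> j _; rewrite /g; case: ifP.
apply: (pcomp_if Hp).
  apply: (@pcomp_expr _ _ _ (ECons (ETl (EVar 0)) ENil)) => j [_].
  by rewrite ttrue_tbool /g => ->.
apply: (@pcomp_expr _ _ _ ENil) => j [_].
by rewrite ttrue_tbool /g => /negbTE ->.
Qed.

Lemma ttrue_tlist l : ttrue (tlist l) = (0 < size l). Proof. by case: l. Qed.

Lemma pcomp_has I (D : I -> Prop) sz (A : eqType) (env : I -> tree)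
    (eA : A -> tree) (l : I -> seq A) (p : I -> A -> bool) :
  pbounded D sz (fun i => size (l i)) ->
  pcomp (fun j : I * A => D j.1 /\ j.2 \in l j.1) (fun j => sz j.1)
    (fun j => Cons (env j.1) (eA j.2)) (fun j => tbool (p j.1 j.2)) ->
  pcomp D sz (fun i => Cons (env i) (tlist (map eA (l i))))
    (fun i => tbool (has (p i) (l i))).
Proof.
move=> Bl Hp; apply: (pcomp_tbool (pcomp_filter Bl Hp)) => i _.
by rewrite ttrue_tlist has_filter; case: (filter _ _).
Qed.

Lemma pcomp_mem :
  pcomp (fun=> True) (fun vX : nat * seq nat => size vX.2)
    (fun vX => Cons (Atom vX.1) (tlist (map Atom vX.2)))
    (fun vX => tbool (vX.1 \in vX.2)).
Proof.
apply: (@pcomp_eqr _ _ _ _ (fun vX => tbool (has (eq_op vX.1) vX.2))).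
  move=> [v X] _ /=; congr tbool; rewrite -has_pred1; apply: eq_has => u.
  exact: eq_sym.
apply: (pcomp_has (p := fun vX => eq_op vX.1)); first exact: pbounded_sz.
by apply: (@pcomp_expr _ _ _ (EEq (EHd (EVar 0)) (ETl (EVar 0)))).
Qed.

(** * Induced subgraphs *)

Local Open Scope fset_scope.

(** [X] may be any list of names: its order, its repetitions and names outside [G] have no effect.
    So [v :: vseq H] describes the addition of a vertex without further care. *)
Definition induced (G : graph) (X : seq nat) : graph :=
  del G [fset v in verts G | v \notin X].

Lemma mem_verts_del G D v : (v \in verts (del G D)) = (v \in verts G) && (v \notin D).
Proof. by rewrite /verts /= !inE andbC. Qed.

Lemma mem_verts_induced G X v :
  (v \in verts (induced G X)) = (v \in verts G) && (v \in X).
Proof. by rewrite mem_verts_del !inE /=; case: (v \in verts G); rewrite ?negbK. Qed.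

Lemma mem_edges_verts G u v :
  (u, v) \in edges G -> (u \in verts G) && (v \in verts G).
Proof.
have /andP[sE _] := gdata_wf G.
by move=> uv; have := fsubsetP sE _ uv; rewrite !inE.
Qed.

Lemma groot_verts G r : groot G = Some r -> r \in verts G.
Proof. by have /andP[_] := gdata_wf G; rewrite /groot => + E; rewrite E. Qed.

Lemma mem_edges_del G D e :
  (e \in edges (del G D)) = [&& e \in edges G, e.1 \notin D & e.2 \notin D].
Proof. by rewrite /edges /= !inE. Qed.

Lemma mem_edges_induced G X e :
  (e \in edges (induced G X)) = [&& e \in edges G, e.1 \in X & e.2 \in X].
Proof.
rewrite mem_edges_del; case: e => u v /=; case E: ((u, v) \in edges G) => //=.
by have /andP[uG vG] := mem_edges_verts E; rewrite !inE uG vG /= !negbK.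
Qed.

Lemma groot_induced G X :
  groot (induced G X) =
  if groot G is Some r then if r \in X then Some r else None else None.
Proof.
rewrite {1}/groot /=; case E: (groot G) => [r|//].
by rewrite !inE (groot_verts E) /=; case: (r \in X).
Qed.

Lemma graph_eq G H :
  verts G = verts H -> edges G = edges H -> groot G = groot H -> G = H.
Proof.
move=> V E R; apply: val_inj => /=.
move: V E R; rewrite /verts /edges /groot.
by case: (gdata G) => -[? ?] ?; case: (gdata H) => -[? ?] ? /= -> -> ->.
Qed.

Lemma mem_vseq G v : (v \in vseq G) = (v \in verts G).
Proof. by rewrite mem_sort. Qed.

Lemma vseq_uniq G : uniq (vseq G).
Proof. by rewrite sort_uniq fset_uniq. Qed.

Lemma size_vseq G : size (vseq G) = nverts G.
Proof. by rewrite size_sort. Qed.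

Lemma isub_induced G X : isub (induced G X) G.
Proof. by eexists. Qed.

(** Edges and root of an induced subgraph are forced by its vertices, so below induced subgraphs of
    [G] are handled as sets of vertices. *)
Lemma isubE H G : isub H G -> H = induced G (vseq H).
Proof.
move=> [D ->]; apply: graph_eq.
- apply/fsetP => v; rewrite mem_verts_induced mem_vseq !mem_verts_del.
  by case: (v \in verts G).
- apply/fsetP => -[u v]; rewrite mem_edges_induced !mem_vseq mem_edges_del /=.
  rewrite !mem_verts_del; case E: ((u, v) \in edges G) => //=.
  by have /andP[-> ->] := mem_edges_verts E.
- rewrite groot_induced {1}/groot /=; case E: (groot G) => [r|//].
  by rewrite mem_vseq mem_verts_del (groot_verts E) /=; case: (r \in D).
Qed.

Lemma induced_eq G X Y :
  (forall v, v \in verts G -> (v \in X) = (v \in Y)) -> induced G X = induced G Y.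
Proof.
move=> XY; rewrite /induced; congr del; apply/fsetP => v; rewrite !inE /=.
by case: (boolP (v \in verts G)) => //= /XY ->.
Qed.

Lemma isub_verts H G : isub H G -> verts H `<=` verts G.
Proof.
by move=> /isubE ->; apply/fsubsetP => v; rewrite mem_verts_induced => /andP[].
Qed.

Lemma isub_nverts H G : isub H G -> nverts H <= nverts G.
Proof. by move=> /isub_verts; apply: fsubset_leq_card. Qed.

Lemma isub_eq G H K : isub H G -> isub K G -> verts H = verts K -> H = K.
Proof.
move=> HG KG HK; rewrite (isubE HG) (isubE KG); apply: induced_eq => v _.
by rewrite !mem_vseq HK.
Qed.

Lemma induced_induced G X Y :
  induced (induced G X) Y = induced G [seq v <- X | v \in Y].
Proof.
apply: graph_eq.
- apply/fsetP => v; rewrite !mem_verts_induced mem_filter.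
  by rewrite -andbA [(v \in X) && _]andbC.
- apply/fsetP => e; rewrite !mem_edges_induced !mem_filter.
  case: (e \in edges G) => //=.
  by case: (e.1 \in X); case: (e.2 \in X); rewrite ?andbT ?andbF.
- rewrite !groot_induced; case: (groot G) => [r|//].
  by rewrite mem_filter; case: (r \in X); rewrite ?andbT ?andbF.
Qed.

Lemma isub_trans K H G : isub K H -> isub H G -> isub K G.
Proof.
move=> /isubE -> /isubE ->; rewrite induced_induced; exact: isub_induced.
Qed.

Lemma isub_le G H K : isub H G -> isub K G -> verts H `<=` verts K -> isub H K.
Proof.
move=> HG KG HK; exists [fset v in verts K | v \notin vseq H].
rewrite -/(induced K (vseq H)) {1}(isubE HG) {1}(isubE KG) induced_induced.
apply: induced_eq => v _; rewrite mem_filter !mem_vseq.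
by case: (boolP (v \in verts H)) => // /(fsubsetP HK) ->.
Qed.

(** Encodings list vertices in increasing order, and filtering preserves the order. Programs thus
    encode an induced subgraph by filtering, without sorting. *)
Lemma vseq_induced G X : vseq (induced G X) = [seq v <- vseq G | v \in X].
Proof.
apply: (sorted_eq leq_trans anti_leq); first exact: sort_sorted leq_total _.
  by apply: sorted_filter leq_trans _ _ _; apply: sort_sorted leq_total _.
apply: uniq_perm; rewrite ?filter_uniq ?vseq_uniq // => v.
by rewrite mem_vseq mem_filter mem_vseq mem_verts_induced andbC.
Qed.

Lemma allpairs_filter (S T : Type) (p : pred S) (q : pred T) s t :
  [seq (u, v) | u <- filter p s, v <- filter q t] =
  [seq e <- [seq (u, v) | u <- s, v <- t] | p e.1 && q e.2].
Proof.
elim: s => //= u s IH; rewrite filter_cat -IH filter_map.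
case pu: (p u) => /=.
  by congr (map _ _ ++ _); apply: eq_filter => v /=; rewrite pu.
suff -> : [seq v <- t | preim (pair u) (fun e => p e.1 && q e.2) v] = [::] by [].
by elim: t {IH} => //= v t ->; rewrite pu.
Qed.

Lemma eseq_induced G X :
  eseq (induced G X) = [seq e <- eseq G | (e.1 \in X) && (e.2 \in X)].
Proof.
rewrite /eseq vseq_induced allpairs_filter -!filter_predI; apply: eq_filter => e /=.
by rewrite mem_edges_induced; case: (e \in edges G); rewrite ?andbF ?andbT ?andbb.
Qed.

Lemma size_eseq G : size (eseq G) <= nverts G * nverts G.
Proof.
by rewrite size_filter (leq_trans (count_size _ _)) // size_allpairs size_vseq.
Qed.

Lemma pcomp_induced :
  pcomp (fun=> True) (fun GX : graph * seq nat => (nverts GX.1 + size GX.2)%N)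
    (fun GX => Cons (tgraph GX.1) (tlist (map Atom GX.2)))
    (fun GX => tgraph (induced GX.1 GX.2)).
Proof.
set sz := (fun GX : _ * _ => (nverts GX.1 + _)%N).
have Bn : pbounded (fun=> True) sz (fun GX => nverts GX.1).
  by apply: pbounded_le (pbounded_sz _ _) => GX _; apply: leq_addr.
have Bs : pbounded (fun=> True) sz (fun GX => size GX.2).
  by apply: pbounded_le (pbounded_sz _ _) => GX _; apply: leq_addl.
apply: pcomp_pair; last apply: pcomp_pair.
- apply: (@pcomp_eqr _ _ _ _ (fun GX => tlist (map Atom
    [seq v <- vseq GX.1 | v \in GX.2]))).
    by move=> GX _; rewrite vseq_induced.
  apply: (@pcomp_comp _ _ _ (fun GX =>
    Cons (tlist (map Atom GX.2)) (tlist (map Atom (vseq GX.1))))).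
    by apply: (@pcomp_expr _ _ _ (ECons (ETl (EVar 0)) (EHd (EHd (EVar 0))))).
  apply: (pcomp_filter (p := fun GX v => v \in GX.2)).
    by apply: pbounded_le Bn => GX _; rewrite size_vseq.
  apply: (@pcomp_call _ _ _ _ _ _ _ _ (ECons (ETl (EVar 0)) (EHd (EVar 0)))
    (fun j => (j.2, j.1.2)) _ _ pcomp_mem) => //.
  by case: Bs => p Bp; exists p => j _; apply: Bp.
- apply: (@pcomp_eqr _ _ _ _ (fun GX => tlist
    [seq Cons (Atom e.1) (Atom e.2) |
       e <- [seq e <- eseq GX.1 | (e.1 \in GX.2) && (e.2 \in GX.2)]])).
    by move=> GX _; rewrite eseq_induced.
  apply: (@pcomp_comp _ _ _ (fun GX => Cons (tlist (map Atom GX.2))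
    (tlist [seq Cons (Atom e.1) (Atom e.2) | e <- eseq GX.1]))).
    by apply: (@pcomp_expr _ _ _
      (ECons (ETl (EVar 0)) (EHd (ETl (EHd (EVar 0)))))).
  apply: (pcomp_filter (p := fun GX e => (e.1 \in GX.2) && (e.2 \in GX.2))).
    by apply: pbounded_le (pboundedM Bn Bn) => GX _; apply: size_eseq.
  apply: pcomp_and.
    apply: (@pcomp_call _ _ _ _ _ _ _ _
      (ECons (EHd (ETl (EVar 0))) (EHd (EVar 0)))
      (fun j => (j.2.1, j.1.2)) _ _ pcomp_mem) => //.
    by case: Bs => p Bp; exists p => j _; apply: Bp.
  apply: (@pcomp_call _ _ _ _ _ _ _ _
    (ECons (ETl (ETl (EVar 0))) (EHd (EVar 0)))
    (fun j => (j.2.2, j.1.2)) _ _ pcomp_mem) => //.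
  by case: Bs => p Bp; exists p => j _; apply: Bp.
- apply: (@pcomp_eqr _ _ _ _ (fun GX => if groot GX.1 is Some r then
      if r \in GX.2 then Atom r else Nil else Nil)).
    move=> GX _; rewrite groot_induced.
    by case: (groot _) => // r; case: (r \in _).
  apply: (@pcomp_if _ _ _ _ _
    (fun GX => if groot GX.1 is Some r then Atom r else Nil)).
  + by apply: (@pcomp_expr _ _ _ (ETl (ETl (EHd (EVar 0))))).
  + have Hm : pcomp (fun GX => True /\
          ttrue (if groot GX.1 is Some r then Atom r else Nil)) sz
        (fun GX => Cons (tgraph GX.1) (tlist (map Atom GX.2)))
        (fun GX => tbool (odflt 0 (groot GX.1) \in GX.2)).
      apply: (@pcomp_call _ _ _ _ _ _ _ _
        (ECons (ETl (ETl (EHd (EVar 0)))) (ETl (EVar 0)))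
        (fun GX => (odflt 0 (groot GX.1), GX.2)) _ _ pcomp_mem) => //.
        by case: Bs => p Bp; exists p => j _; apply: Bp.
      by move=> GX [_] /=; case: (groot GX.1).
    apply: (pcomp_if Hm).
      apply: (@pcomp_expr _ _ _ (ETl (ETl (EHd (EVar 0))))) => GX [[_]].
      by rewrite ttrue_tbool /=; case: (groot GX.1) => //= r _ ->.
    apply: (@pcomp_expr _ _ _ ENil) => GX [[_]].
    by rewrite ttrue_tbool /=; case: (groot GX.1) => //= r _ /negbTE ->.
  + apply: (@pcomp_expr _ _ _ ENil) => GX [_] /=.
    by case: (groot GX.1).
Qed.

(** * Strong accessibility *)

Lemma isub_refl G : isub G G.
Proof.
exists fset0; apply: graph_eq.
- by apply/fsetP => v; rewrite mem_verts_del in_fset0 andbT.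
- by apply/fsetP => e; rewrite mem_edges_del !in_fset0 !andbT.
- by rewrite {2}/groot /=; case: (groot G).
Qed.

Lemma isub_strict_vertex H K : isub_strict H K ->
  exists2 v, v \in verts K & v \notin verts H.
Proof.
move=> [HK neqHK]; case: (boolP (verts K `<=` verts H)) => [KH|/fsubsetPn //].
case: neqHK; apply: (isub_eq HK (isub_refl K)).
by apply/eqP; rewrite eqEfsubset KH isub_verts.
Qed.

Lemma verts_add H K v : isub H K -> v \in verts K ->
  verts (induced K (v :: vseq H)) = v |` verts H.
Proof.
move=> HK vK; apply/fsetP => u; rewrite mem_verts_induced !inE mem_vseq.
case: eqP => [->|_] /=; first by rewrite vK.
by case: (boolP (u \in verts H)) => uH; rewrite ?andbF ?(fsubsetP (isub_verts HK)).
Qed.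

Lemma isub_add H K v : isub H K -> isub H (induced K (v :: vseq H)).
Proof.
move=> HK; apply: (isub_le HK (isub_induced _ _)); apply/fsubsetP => u uH.
by rewrite mem_verts_induced inE mem_vseq uH (fsubsetP (isub_verts HK)) ?orbT.
Qed.

Lemma isub_edge H K u v : isub H K -> edge H u v -> edge K u v.
Proof. by move=> /isubE ->; rewrite /edge mem_edges_induced => /andP[]. Qed.

Lemma isub_uedge H K u v : isub H K -> uedge H u v -> uedge K u v.
Proof. by move=> HK /orP[]/(isub_edge HK) E; rewrite /uedge E ?orbT. Qed.

Lemma edge_add H K a b : isub H K -> a \in verts H ->
  (edge (induced K (b :: vseq H)) a b = edge K a b) *
  (edge (induced K (b :: vseq H)) b a = edge K b a).
Proof.
move=> HK aH; rewrite /edge !mem_edges_induced /= !inE !mem_vseq aH !eqxx.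
by rewrite orbT !andbT.
Qed.

Lemma reachable_refl e u : reachable e u u.
Proof. by exists [::]. Qed.

Lemma reachable_trans e u v w : reachable e u v -> reachable e v w -> reachable e u w.
Proof.
move=> [p Hp <-] [q Hq <-]; exists (p ++ q); last by rewrite last_cat.
by rewrite cat_path Hp.
Qed.

Lemma reachable_step (e : rel nat) u v : e u v -> reachable e u v.
Proof. by move=> uv; exists [:: v] => //=; rewrite uv. Qed.

Lemma reachable_sub (e e' : rel nat) u v :
  subrel e e' -> reachable e u v -> reachable e' u v.
Proof. by move=> ee' [p Hp Hl]; exists p => //; apply: sub_path Hp. Qed.

Lemma reachable_exit (e : rel nat) (X : {fset nat}) u v :
  reachable e u v -> u \in X -> v \notin X ->
  exists a b, [/\ a \in X, b \notin X & e a b].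
Proof.
move=> [p + <-]; elim: p u => [|w p IH] u /=; first by move=> _ ->.
move=> /andP[uw wp] uX lX; case: (boolP (w \in X)) => wX; first exact: IH wp wX lX.
by exists u, w.
Qed.

(** The larger member [K] is its own ambient graph. Inside any [G] having [K] as an induced
    subgraph, adding [v] gives the same graph. *)
Definition strongly_accessible (P : graph -> Prop) : Prop :=
  forall H K, P H -> P K -> isub_strict H K ->
  exists2 v, (v \in verts K) && (v \notin verts H) & P (induced K (v :: vseq H)).

Definition root_seq (G : graph) : seq nat := seq_of_opt (groot G).

Lemma hereditary_accessible P : hereditary P -> strongly_accessible P.
Proof.
move=> hP H K PH PK HK; have [v vK vH] := isub_strict_vertex HK.
by exists v; [rewrite vK vH | apply: hP PK (isub_induced _ _)].
Qed.

(** A path of [K] from a vertex of [H] to one outside leaves [H] by some edge, and adding the outer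
    end of that edge keeps [H] connected. If [H] is empty, any single vertex will do. *)
Lemma connected_hereditary_accessible P :
  connected_hereditary P -> strongly_accessible P.
Proof.
move=> [Pc hP] H K PH PK sHK; have [v vK vH] := isub_strict_vertex sHK.
have HK := sHK.1; case: (boolP (verts H == fset0)) => [/eqP H0|/fset0Pn[u uH]].
  exists v; first by rewrite vK vH.
  apply: hP PK (isub_induced _ _) _ => a b; rewrite !verts_add // H0 fsetU0.
  by rewrite !inE => /eqP -> /eqP ->; apply: reachable_refl.
have uK := fsubsetP (isub_verts HK) _ uH.
have [a [b [aH bH ab]]] := reachable_exit (Pc _ PK u v uK vK) uH vH.
have bK : b \in verts K by case/orP: ab => /mem_edges_verts/andP[].
exists b; first by rewrite bK bH.
apply: hP PK (isub_induced _ _) _; set L := induced _ _.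
have HL : isub H L by apply: isub_add.
have conn x y : x \in verts H -> y \in verts H -> reachable (uedge L) x y.
  move=> xH yH; apply: reachable_sub (Pc _ PH x y xH yH) => i j.
  exact: isub_uedge.
have abL : uedge L a b by rewrite /uedge /L !edge_add.
have baL : uedge L b a by rewrite /uedge orbC.
move=> x y; rewrite !verts_add // !inE.
move=> /orP[/eqP->|xH] /orP[/eqP->|yH].
- exact: reachable_refl.
- exact: reachable_trans (reachable_step baL) (conn _ _ aH yH).
- exact: reachable_trans (conn _ _ xH aH) (reachable_step abL).
- exact: conn.
Qed.

Lemma isub_root H K r : isub H K -> groot H = Some r -> groot K = Some r.
Proof.
by move=> /isubE ->; rewrite groot_induced; case: (groot K) => // r'; case: ifP.
Qed.

(** [H] and [K] share their root. A directed path of [K] from it to a vertex outside [H] leaves [H]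
    by an edge, whose outer end is reachable from the root through [H]. *)
Lemma rooted_hereditary_accessible P :
  rooted_hereditary P -> strongly_accessible P.
Proof.
move=> [Pr hP] H K PH PK sHK; have [v vK vH] := isub_strict_vertex sHK.
have HK := sHK.1; have [r rH Hr] := Pr _ PH.
have rK := isub_root HK rH.
have [r' + Kr] := Pr _ PK; rewrite rK => -[rr']; rewrite -{r'}rr' in Kr.
have [a [b [aH bH ab]]] := reachable_exit (Kr v vK) (groot_verts rH) vH.
have bK : b \in verts K by case/mem_edges_verts/andP: ab.
exists b; first by rewrite bK bH.
apply: hP PK (isub_induced _ _) _; set L := induced _ _.
have HL : isub H L by apply: isub_add.
exists r; first exact: isub_root HL rH.
have conn x : x \in verts H -> reachable (edge L) r x.
  by move=> xH; apply: reachable_sub (Hr x xH) => i j; apply: isub_edge.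
move=> x; rewrite verts_add // !inE => /orP[/eqP->|]; last exact: conn.
apply: reachable_trans (conn a aH) (reachable_step _).
by rewrite /L edge_add.
Qed.

(** The empty graph is connected but not rooted, hence the second candidate: a rooted induced
    subgraph of [G] contains the root of [G], and the root alone is rooted. *)
Lemma seed P G H :
  hereditary P \/ connected_hereditary P \/ rooted_hereditary P ->
  isub H G -> P H ->
  exists2 S, S \in [:: induced G [::]; induced G (root_seq G)] &
    P S /\ verts S `<=` verts H.
Proof.
move=> hP HG PH.
have V0 : verts (induced G [::]) = fset0.
  by apply/fsetP => v; rewrite mem_verts_induced andbF.
have iH0 : isub (induced G [::]) H.
  by apply: (isub_le (isub_induced _ _) HG); rewrite V0 fsub0set.
case: hP => [hP|[[_ hP]|[Pr hP]]].
- by exists (induced G [::]); rewrite ?mem_head //; split;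
    [apply: hP PH iH0 | rewrite V0 fsub0set].
- exists (induced G [::]); rewrite ?mem_head //; split; last by rewrite V0 fsub0set.
  by apply: hP PH iH0 _ => u v; rewrite V0.
have [r rH _] := Pr _ PH; have rG := isub_root HG rH.
have Vr : verts (induced G (root_seq G)) = [fset r].
  apply/fsetP => v; rewrite mem_verts_induced /root_seq rG !inE.
  by case: eqP => [->|]; rewrite ?andbF ?(groot_verts rG).
have sr : [fset r] `<=` verts H by rewrite fsub1set groot_verts.
exists (induced G (root_seq G)); first by rewrite !inE eqxx orbT.
rewrite Vr; split=> //; apply: hP PH _ _.
  by apply: (isub_le (isub_induced _ _) HG); rewrite Vr.
exists r; first by rewrite groot_induced /root_seq rG /= inE eqxx.
by move=> v; rewrite Vr inE => /eqP ->; apply: reachable_refl.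
Qed.

(** * Greedy extension *)

Section Extension.

Variables (P : graph -> Prop) (Pb : pred graph).
Hypothesis PbP : forall G, Pb G <-> P G.
Hypothesis accP : strongly_accessible P.

Definition try_add (G H : graph) (v : nat) : graph :=
  let K := induced G (v :: vseq H) in if Pb K then K else H.

Definition try_all (G H : graph) : graph := foldl (try_add G) H (vseq G).

(** A vertex rejected early in a pass may become addable later, for instance once a neighbour has
    been added, so passes are repeated. The list [vseq G] only serves as a counter here. *)
Definition extend (G H : graph) : graph :=
  foldl (fun K _ => try_all G K) H (vseq G).

Definition psub_above G H K := [/\ isub K G, P K & verts H `<=` verts K].

Lemma psub_above_trans G H K L :
  psub_above G H K -> psub_above G K L -> psub_above G H L.
Proof. by move=> [_ _ HK] [LG PL KL]; split=> //; apply: fsubset_trans KL. Qed.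

Lemma try_add_above G H v : isub H G -> P H -> psub_above G H (try_add G H v).
Proof.
move=> HG PH; rewrite /try_add; case: ifP => [/PbP PK|_]; last by split.
by split=> //; [apply: isub_induced | apply/isub_verts/isub_add].
Qed.

Lemma foldl_above T (f : graph -> T -> graph) G s H :
  (forall K v, isub K G -> P K -> psub_above G K (f K v)) ->
  isub H G -> P H -> psub_above G H (foldl f H s).
Proof.
move=> fG; elim: s H => [|v s IH] H HG PH //=.
have fH := fG H v HG PH; apply: psub_above_trans (fH) _.
by case: fH => ? ? _; apply: IH.
Qed.

Lemma try_all_above G H : isub H G -> P H -> psub_above G H (try_all G H).
Proof. by apply: foldl_above => K v; apply: try_add_above. Qed.

Lemma extend_above G H : isub H G -> P H -> psub_above G H (extend G H).
Proof. by apply: foldl_above => K v; apply: try_all_above. Qed.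

(** If [H] were not maximal, accessibility would give an addable vertex [v]. Graphs only grow during
    a pass that ends in [H], so the graph is still [H] when [v] is tried; then [v] is added and
    never removed. *)
Lemma try_all_fixed_max G H : isub H G -> P H ->
  verts (try_all G H) `<=` verts H -> max_psubgraph P G H.
Proof.
move=> HG PH fixH; split=> // K [KG PK] sHK.
have [v /andP[vK vH] Pv] := accP PH PK sHK.
have vG := fsubsetP (isub_verts KG) _ vK.
have HK := sHK.1; move: Pv.
have -> : induced K (v :: vseq H) = induced G (v :: vseq H).
  apply: (isub_eq (isub_trans (isub_induced _ _) KG) (isub_induced _ _)).
  by rewrite !verts_add.
move=> Pv; move: fixH; rewrite /try_all.
have /path.splitPr[s1 s2] : v \in vseq G by rewrite mem_vseq.
rewrite foldl_cat /=.
have [H1G PH1 HH1] := @foldl_above _ _ G s1 H (@try_add_above G) HG PH.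
set H1 := foldl _ _ s1 in H1G PH1 HH1 *.
have [H2G PH2 H12] := @try_add_above G H1 v H1G PH1.
have [_ _ H23] := @foldl_above _ _ G s2 _ (@try_add_above G) H2G PH2.
move=> fixH; have H1E : H1 = H.
  apply: (isub_eq H1G HG); apply/eqP; rewrite eqEfsubset HH1 andbT.
  exact: fsubset_trans H12 (fsubset_trans H23 fixH).
have : v \in verts (try_add G H1 v).
  by rewrite H1E /try_add; move/PbP: Pv => ->; rewrite verts_add // !inE eqxx.
by move=> /(fsubsetP H23)/(fsubsetP fixH); rewrite (negPf vH).
Qed.

Lemma extend_max G H : isub H G -> P H -> max_psubgraph P G (extend G H).
Proof.
move=> HG PH; have [EG PE _] := extend_above HG PH.
apply: try_all_fixed_max => //.
(* Either some pass changed nothing, and then all later ones change nothing, or each of the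
   [nverts G] passes added a vertex, which exhausts [G]. *)
have: verts (try_all G (extend G H)) `<=` verts (extend G H) \/
      size (vseq G) + nverts H <= nverts (extend G H).
  rewrite /extend; elim: (vseq G) (H) HG PH => [|v s IH] K KG PK; first by right.
  have [AG PA KA] := try_all_above KG PK.
  case: (boolP (verts (try_all G K) `<=` verts K)) => [fixK|nfixK].
    have AK : try_all G K = K.
      by apply: (isub_eq AG KG); apply/eqP; rewrite eqEfsubset fixK.
    left; suff -> : foldl (fun K _ => try_all G K) K (v :: s) = K by [].
    by elim: (v :: s) => //= _ s' IHs; rewrite AK.
  have [|] := IH _ AG PA; first by left.
  move=> le_s; right; apply: leq_trans le_s; rewrite /= addSnnS leq_add2l.
  by apply: fproper_ltn_card; rewrite fproperE KA.
case=> //; rewrite size_vseq => le_GE.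
have -> : verts (extend G H) = verts G.
  apply/eqP; rewrite eqEfcard isub_verts //=.
  by apply: leq_trans le_GE; apply: leq_addr.
by have [/isub_verts] := try_all_above EG PE.
Qed.

End Extension.

(** * Output size *)

(* Sharing lets the size of a tree grow exponentially in time, but its height,
   hence the length of a list, grows only linearly. *)
Fixpoint height (t : tree) : nat :=
  if t is Cons a b then (maxn (height a) (height b)).+1 else 0.

Lemma height_Cons a b : height (Cons a b) = (maxn (height a) (height b)).+1.
Proof. by []. Qed.

(** New nodes come from [ECons] and [EEq] only, and both are charged in [ecost]. *)
Lemma height_eval s e h :
  (forall y, height (s y) <= h) -> height (eval s e) <= h + ecost e.
Proof.
move=> sh; elim: e => [x||i|e1 IH1 e2 IH2|e IH|e IH|e1 _ e2 _] //=.
- by apply: leq_trans (sh x) (leq_addr _ _).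
- lia.
- by move: IH; case: (eval s e) => //= a b; lia.
- by move: IH; case: (eval s e) => //= a b; lia.
- by case: (atom_eq _ _) => /=; lia.
Qed.

Lemma height_upd s x t h :
  (forall y, height (s y) <= h) -> height t <= h ->
  forall y, height (upd s x t y) <= h.
Proof. by move=> sh th y; rewrite /upd; case: ifP. Qed.

Lemma height_exec c s t o s' : exec c s t o s' ->
  forall h, (forall y, height (s y) <= h) -> forall y, height (s' y) <= h + t.
Proof.
have weak s0 h h' : (forall y, height (s0 y) <= h) -> h <= h' ->
    forall y, height (s0 y) <= h' by move=> H hh y; apply: leq_trans (H y) hh.
elim=> {c s t o s'}.
- by move=> s h sh; apply: weak sh _; apply: leq_addr.
- move=> x e s h sh; apply: height_upd; first by apply: weak sh _; apply: leq_addr.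
  by apply: leq_trans (height_eval e sh) _; lia.
- by move=> e s h sh; apply: weak sh _; apply: leq_addr.
- move=> c1 c2 s1 s2 s3 t1 t2 o1 o2 _ IH1 _ IH2 h sh y.
  by rewrite addnA; apply/IH2/IH1.
- move=> e c1 c2 s s' t o _ IH h sh; apply: weak (IH _ sh) _; lia.
- by move=> e c s _ h sh; apply: weak sh _; apply: leq_addr.
- move=> e c s s' t o _ _ IH h sh; apply: weak (IH _ sh) _; lia.
- move=> x c e s s' t o _ IH h sh; apply: height_upd.
    by apply: weak sh _; apply: leq_addr.
  apply: leq_trans (IH (h + ecost e)%N _ 0) _; last by lia.
  by apply: height_upd => //; apply: height_eval.
Qed.

Lemma height_returns c x y t : returns c x y t -> height y <= height x + t.
Proof.
by move=> [s E <-]; apply: (height_exec E); apply: height_upd.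
Qed.

Lemma size_tlist l : size l <= height (tlist l).
Proof.
by elim: l => //= a l IH; rewrite ltnS; apply: leq_trans IH (leq_maxr _ _).
Qed.

Lemma height_tlist (A : Type) (f : A -> tree) l h :
  (forall a, height (f a) <= h) -> height (tlist (map f l)) <= size l + h.
Proof.
move=> fh; elim: l => //= a l IH; rewrite addSn ltnS geq_max IH andbT.
by apply: leq_trans (fh a) _; apply: leq_addl.
Qed.

Lemma height_tgraph G : height (tgraph G) <= nverts G + nverts G * nverts G + 4.
Proof.
have hV := @height_tlist _ (fun v => Atom v) (vseq G) 0 (fun=> isT).
have hE := @height_tlist _ (fun e : nat * nat => Cons (Atom e.1) (Atom e.2))
  (eseq G) 1 (fun=> isT).
have := size_eseq G; rewrite size_vseq addn0 in hV.
have hR : height (if groot G is Some r then Atom r else Nil) = 0.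
  by case: (groot G).
by rewrite /tgraph !height_Cons hR; lia.
Qed.

(** * The exchange step *)

Section Exchange.

Variables (P : graph -> Prop) (Pb : pred graph) (io : graph -> nat -> seq graph).
Hypothesis PbP : forall G, Pb G <-> P G.
Hypothesis accP : strongly_accessible P.
Hypothesis hP : hereditary P \/ connected_hereditary P \/ rooted_hereditary P.
Hypothesis ioP : forall G v, almost_satisfies P G -> v \in verts G ->
  lists (io G v) (max_psubgraph_at P G v).

(** The promise of the io-restricted problem is established only for [v] outside [X]; a vertex of
    [X] calls for no exchange. *)
Definition exchange (G X : graph) (v : nat) : seq graph :=
  if v \in vseq X then [::] else io (induced G (v :: vseq X)) v.

Definition seeds (G : graph) : seq graph :=
  filter Pb [:: induced G [::]; induced G (root_seq G)].

Definition starts (G : graph) (N : seq graph) : seq graph :=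
  seeds G ++ flatten [seq flatten [seq exchange G X v | v <- vseq G] | X <- N].

(** Between maximal [P]-subgraphs inclusion of vertex sets means equality, so this is a membership
    test that compares vertices only. *)
Definition covered (N : seq graph) (K : graph) : bool :=
  has (fun X => verts K `<=` verts X) N.

(** Repetitions may occur in this list; the enumeration takes its head only and then computes a new
    list. *)
Definition fresh (G : graph) (N : seq graph) : seq graph :=
  [seq K <- map (extend Pb G) (starts G N) | ~~ covered N K].

Definition all_max (G : graph) (N : seq graph) : Prop :=
  forall X, X \in N -> max_psubgraph P G X.

(** Deleting [v] from [G[X + v]] gives back [X], which satisfies [P]: this is the promise of the
    io-restricted problem. *)
Lemma almost_add G X v : isub X G -> P X -> v \in verts G -> v \notin verts X ->
  almost_satisfies P (induced G (v :: vseq X)) /\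
  v \in verts (induced G (v :: vseq X)).
Proof.
move=> XG PX vG vX; have vI : v \in verts (induced G (v :: vseq X)).
  by rewrite verts_add // !inE eqxx.
split=> //; exists v => //.
suff -> : del_vertex (induced G (v :: vseq X)) v = X by [].
apply: (isub_eq _ XG).
  by apply: isub_trans (isub_induced _ _); eexists.
apply/fsetP => u; rewrite mem_verts_del verts_add // !inE.
by case: eqP => [->|_] /=; rewrite ?andbT ?(negPf vX).
Qed.

Lemma exchangeP G X v : isub X G -> P X -> v \in verts G -> v \notin verts X ->
  lists (exchange G X v) (max_psubgraph_at P (induced G (v :: vseq X)) v).
Proof.
move=> XG PX vG vX; rewrite /exchange mem_vseq (negPf vX).
by have [aG vI] := almost_add XG PX vG vX; apply: ioP.
Qed.

Lemma exchange_psub G X v S : isub X G -> P X -> v \in verts G ->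
  S \in exchange G X v -> isub S G /\ P S.
Proof.
move=> XG PX vG; case: (boolP (v \in verts X)) => vX.
  by rewrite /exchange mem_vseq vX.
case: (exchangeP XG PX vG vX) => _ /[apply] -[[[SI PS] _] _].
by split=> //; apply: isub_trans SI (isub_induced _ _).
Qed.

Lemma starts_psub G N S : all_max G N -> S \in starts G N -> isub S G /\ P S.
Proof.
move=> NG; rewrite mem_cat => /orP[|].
  rewrite mem_filter !inE => /andP[/PbP PS] /orP[] /eqP ES.
    by split=> //; rewrite ES; apply: isub_induced.
  by split=> //; rewrite ES; apply: isub_induced.
move=> /flatten_mapP[X XN] /flatten_mapP[v vG].
have [[XG PX] _] := NG X XN; apply: exchange_psub => //.
by rewrite -mem_vseq.
Qed.

Lemma fresh_max G N K : all_max G N -> K \in fresh G N ->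
  max_psubgraph P G K /\ K \notin N.
Proof.
move=> NG; rewrite mem_filter => /andP[nK] /mapP[S SN EK].
have [SG PS] := starts_psub NG SN.
split; first by rewrite EK; apply: (extend_max PbP accP).
apply: contra nK => KN; apply/hasP; exists K => //; exact: fsubset_refl.
Qed.

Lemma max_psubgraph_eq G K X : max_psubgraph P G K -> psubgraph P G X ->
  verts K `<=` verts X -> K = X.
Proof.
move=> [[KG PK] maxK] [XG PX] KX.
case: (eqVneq K X) => // /eqP neqKX; case: (maxK X (conj XG PX)).
by split=> //; apply: (isub_le KG XG).
Qed.

(* Grow a common member [C] of [X] and [Y], with [X] in [N], one vertex of [Y]
   at a time; if that vertex is outside [X], exchange replaces [X]. *)
Lemma fresh_complete G N : all_max G N -> fresh G N = [::] ->
  forall Y, max_psubgraph P G Y -> Y \in N.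
Proof.
move=> NG fN Y maxY; have [[YG PY] _] := maxY.
(* As nothing is fresh, the extension is covered by some graph of [N], and equals it by
   maximality. *)
have inN S : S \in starts G N -> extend Pb G S \in N.
  move=> SN; have [SG PS] := starts_psub NG SN.
  have : covered N (extend Pb G S).
    apply/negPn/negP => nc.
    have : extend Pb G S \in fresh G N by rewrite mem_filter nc map_f.
    by rewrite fN.
  move=> /hasP[X XN KX].
  suff -> : extend Pb G S = X by [].
  by have [XG _] := NG X XN; apply: max_psubgraph_eq XG KX; apply: (extend_max PbP).
(* Induction on the number of vertices of [Y] still missing from [C]; [X] may change at every
   step. *)
have grow n C X : X \in N -> isub C G -> P C -> verts C `<=` verts X ->
    verts C `<=` verts Y -> nverts Y - nverts C <= n -> Y \in N.
  elim: n C X => [|n IH] C X XN CG PC CX CY len.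
    have <- : X = Y; last by [].
    have YE : Y = C.
      apply: (isub_eq YG CG); apply/esym/eqP; rewrite eqEfcard CY.
      by rewrite -subn_eq0 -leqn0.
    by have [XG _] := NG X XN; rewrite (max_psubgraph_eq maxY XG) // YE.
  have [XG PX] := (NG X XN).1.
  case: (eqVneq C Y) => [EC|/eqP neqCY].
    by rewrite (max_psubgraph_eq maxY (conj XG PX)) // -EC.
  have CsY : isub C Y by apply: (isub_le CG YG).
  have [v /andP[vY vC] Pv] := accP PC PY (conj CsY neqCY).
  have vG := fsubsetP (isub_verts YG) _ vY.
  set C' := induced Y (v :: vseq C) in Pv.
  have C'Y : isub C' Y by apply: isub_induced.
  have C'G : isub C' G by apply: isub_trans C'Y YG.
  have VC' : verts C' = v |` verts C by rewrite verts_add.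
  have len' : nverts Y - nverts C' <= n.
    by rewrite {2}/nverts VC' cardfsU1 vC -/(nverts C); lia.
  case: (boolP (v \in verts X)) => vX.
    apply: IH XN C'G Pv _ (isub_verts C'Y) len'.
    by rewrite VC' fsubUset fsub1set vX.
  set L := induced G (v :: vseq X).
  have LG : isub L G by apply: isub_induced.
  have C'L : isub C' L.
    apply: (isub_le C'G LG); rewrite VC' verts_add // fsetUS //.
  (* [Z] is maximal in [G[X + v]] and contains [v], so it is listed, but it need not be maximal in
     [G]. Its extension in [G] lies in [N] and still contains [C']. *)
  pose Z := extend Pb L C'.
  have [_ PZ C'Z] := extend_above PbP C'L Pv.
  have ZL : Z \in exchange G X v.
    apply/(exchangeP XG PX vG vX).2; split; first exact: (extend_max PbP).
    by apply: (fsubsetP C'Z); rewrite VC' !inE eqxx.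
  have Zs : Z \in starts G N.
    rewrite mem_cat; apply/orP; right; apply/flatten_mapP; exists X => //.
    by apply/flatten_mapP; exists v; rewrite ?mem_vseq.
  have [ZG _] := starts_psub NG Zs.
  apply: IH (inN Z Zs) C'G Pv _ (isub_verts C'Y) len'.
  by have [_ _] := extend_above PbP ZG PZ; apply: fsubset_trans.
have [S Ss [PS SY]] := seed hP YG PY.
have SN : S \in starts G N.
  by rewrite mem_cat mem_filter Ss andbT; apply/orP; left; apply/PbP.
have [SG _] := starts_psub NG SN.
have [_ _ SE] := extend_above PbP SG PS.
exact: grow (inN S SN) SG PS SE SY (leqnn _).
Qed.

End Exchange.

(** * Computing the exchange step *)

Section ComputeExchange.

Variables (P : graph -> Prop) (Pb : pred graph) (io : graph -> nat -> seq graph).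
Hypothesis PbP : forall G, Pb G <-> P G.
Hypothesis ioP : forall G v, almost_satisfies P G -> v \in verts G ->
  lists (io G v) (max_psubgraph_at P G v).
Hypothesis comp_Pb : pcomp (fun=> True) nverts tgraph (fun G => tbool (Pb G)).
Hypothesis comp_io :
  pcomp (fun Gv : graph * nat => almost_satisfies P Gv.1 /\ Gv.2 \in verts Gv.1)
    (fun Gv => nverts Gv.1) (fun Gv => Cons (tgraph Gv.1) (Atom Gv.2))
    (fun Gv => tgraphs (io Gv.1 Gv.2)).

Lemma pcomp_add :
  pcomp (fun i : graph * graph * nat => isub i.1.2 i.1.1) (fun i => nverts i.1.1)
    (fun i => Cons (tgraph i.1.1) (Cons (tgraph i.1.2) (Atom i.2)))
    (fun i => tgraph (induced i.1.1 (i.2 :: vseq i.1.2))).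
Proof.
apply: (@pcomp_call _ _ _ _ _ _ _ _
  (ECons (EHd (EVar 0)) (ECons (ETl (ETl (EVar 0))) (EHd (EHd (ETl (EVar 0))))))
  (fun i => (i.1.1, i.2 :: vseq i.1.2)) _ _ pcomp_induced) => //=.
apply: (pbounded_le (g := fun i => (nverts i.1.1 + nverts i.1.1 + 1)%N)).
  by move=> i /isub_nverts; rewrite size_vseq; lia.
by apply: pboundedD (pbounded_const _ _ _); apply: pboundedD; apply: pbounded_sz.
Qed.

Lemma pcomp_try_add :
  pcomp (fun i : graph * graph * nat => isub i.1.2 i.1.1) (fun i => nverts i.1.1)
    (fun i => Cons (tgraph i.1.1) (Cons (tgraph i.1.2) (Atom i.2)))
    (fun i => tgraph (try_add Pb i.1.1 i.1.2 i.2)).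
Proof.
apply: (pcomp_let pcomp_add).
apply: (@pcomp_if _ _ _ _ _
  (fun i => tbool (Pb (induced i.1.1 (i.2 :: vseq i.1.2))))).
- apply: (@pcomp_call _ _ _ _ _ _ _ _ (ETl (EVar 0)) _ _ _ comp_Pb) => //.
  apply: pbounded_le (pbounded_sz _ _) => i _.
  exact/isub_nverts/isub_induced.
- apply: (@pcomp_expr _ _ _ (ETl (EVar 0))) => i [_].
  by rewrite ttrue_tbool /try_add => ->.
- apply: (@pcomp_expr _ _ _ (EHd (ETl (EHd (EVar 0))))) => i [_].
  by rewrite ttrue_tbool /try_add => /negbTE ->.
Qed.

Lemma try_add_isub G H v : isub H G -> isub (try_add Pb G H v) G.
Proof. by move=> HG; rewrite /try_add; case: ifP => // _; apply: isub_induced. Qed.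

Lemma try_all_isub G H : isub H G -> isub (try_all Pb G H) G.
Proof.
rewrite /try_all; elim: (vseq G) H => //= v s IH H HG.
by apply/IH/try_add_isub.
Qed.

Lemma pcomp_try_all :
  pcomp (fun i : graph * graph => isub i.2 i.1) (fun i => nverts i.1)
    (fun i => Cons (tgraph i.1) (tgraph i.2))
    (fun i => tgraph (try_all Pb i.1 i.2)).
Proof.
apply: (@pcomp_comp _ _ _ (fun i =>
  Cons (tgraph i.1) (Cons (tgraph i.2) (tlist (map Atom (vseq i.1)))))).
  by apply: (@pcomp_expr _ _ _
    (ECons (EHd (EVar 0)) (ECons (ETl (EVar 0)) (EHd (EHd (EVar 0)))))).
(* Accumulators stay induced subgraphs of the input graph, so their size never exceeds its number of
   vertices. *)
apply: (@pcomp_fold _ _ _ _ _ (fun i => tgraph i.1) Atom tgraph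
  (fun i K => isub K i.1) (fun i => vseq i.1) snd (fun i => try_add Pb i.1)) => //.
- by move=> i K v _ KG _; apply: try_add_isub.
- by apply: pbounded_le (pbounded_sz _ _) => i _; rewrite size_vseq.
- apply: (@pcomp_call _ _ _ _ _ _ _ _ (EVar 0)
    (fun j => (j.1.1.1, j.1.2, j.2)) _ _ pcomp_try_add) => //.
    by move=> j [].
  exact: pbounded_sz.
Qed.

Lemma pcomp_extend :
  pcomp (fun i : graph * graph => isub i.2 i.1) (fun i => nverts i.1)
    (fun i => Cons (tgraph i.1) (tgraph i.2))
    (fun i => tgraph (extend Pb i.1 i.2)).
Proof.
apply: (@pcomp_comp _ _ _ (fun i =>
  Cons (tgraph i.1) (Cons (tgraph i.2) (tlist (map Atom (vseq i.1)))))).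
  by apply: (@pcomp_expr _ _ _
    (ECons (EHd (EVar 0)) (ECons (ETl (EVar 0)) (EHd (EHd (EVar 0)))))).
apply: (@pcomp_fold _ _ _ _ _ (fun i => tgraph i.1) Atom tgraph
  (fun i K => isub K i.1) (fun i => vseq i.1) snd
  (fun i K _ => try_all Pb i.1 K)) => //.
- by move=> i K v _ KG _; apply: try_all_isub.
- by apply: pbounded_le (pbounded_sz _ _) => i _; rewrite size_vseq.
- apply: (@pcomp_call _ _ _ _ _ _ _ _
    (ECons (EHd (EVar 0)) (EHd (ETl (EVar 0))))
    (fun j => (j.1.1.1, j.1.2)) _ _ pcomp_try_all) => //.
    by move=> j [].
  exact: pbounded_sz.
Qed.

Definition exchange_dom (i : graph * graph * nat) :=
  [/\ isub i.1.2 i.1.1, P i.1.2 & i.2 \in verts i.1.1].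

Lemma pcomp_exchange :
  pcomp exchange_dom (fun i => nverts i.1.1)
    (fun i => Cons (tgraph i.1.1) (Cons (tgraph i.1.2) (Atom i.2)))
    (fun i => tgraphs (exchange io i.1.1 i.1.2 i.2)).
Proof.
apply: (@pcomp_if _ _ _ _ _ (fun i => tbool (i.2 \in vseq i.1.2))).
- apply: (@pcomp_call _ _ _ _ _ _ _ _
    (ECons (ETl (ETl (EVar 0))) (EHd (EHd (ETl (EVar 0)))))
    (fun i => (i.2, vseq i.1.2)) _ _ pcomp_mem) => //.
  apply: pbounded_le (pbounded_sz _ _) => i [/isub_nverts XG _ _].
  by rewrite size_vseq.
- apply: (@pcomp_expr _ _ _ ENil) => i [_].
  by rewrite ttrue_tbool /exchange => ->.
- apply: (@pcomp_let _ _ _ (fun i => tgraph (induced i.1.1 (i.2 :: vseq i.1.2)))).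
    by apply: pcomp_subdom pcomp_add => i [[]].
  apply: (@pcomp_call _ _ _ _ _ _ _ _
    (ECons (ETl (EVar 0)) (ETl (ETl (EHd (EVar 0)))))
    (fun i => (induced i.1.1 (i.2 :: vseq i.1.2), i.2)) _ _ comp_io) => //.
  + move=> i [[XG PX vG]]; rewrite ttrue_tbool mem_vseq; exact: almost_add.
  + apply: pbounded_le (pbounded_sz _ _) => i _.
    exact/isub_nverts/isub_induced.
  + by move=> i [_]; rewrite ttrue_tbool /exchange => /negbTE ->.
Qed.

(** The number of answers of the io-restricted problem is bounded through the height of the computed
    tree, which is at most the height of the input plus the running time. Later loops run once per
    answer and rely on this. *)
Lemma size_exchange :
  pbounded exchange_dom (fun i => nverts i.1.1)
    (fun i => size (exchange io i.1.1 i.1.2 i.2)).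
Proof.
have [c [p Hc]] := pcomp_exchange.
pose n (i : graph * graph * nat) := nverts i.1.1.
pose B (i : graph * graph * nat) := (n i + n i * n i + 4)%N.
(* [B] bounds the height of the encoding of either graph; 2 accounts for the two [Cons] of the
   input. *)
apply: (pbounded_le (g := fun i => (B i + B i + 2 + p.[n i]%R)%N)).
  move=> i Di; have [t /height_returns R tp] := Hc i Di.
  have := size_tlist [seq tgraph H | H <- exchange io i.1.1 i.1.2 i.2].
  rewrite size_map => /leq_trans; apply; apply: (leq_trans R).
  have := isub_nverts (let: And3 XG _ _ := Di in XG).
  move=> le_n; have h1 : height (tgraph i.1.1) <= B i by apply: height_tgraph.
  have h2 : height (tgraph i.1.2) <= B i.
    apply: leq_trans (height_tgraph _) _; rewrite leq_add2r.
    exact: leq_add le_n (leq_mul le_n le_n).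
  have h3 : height (Atom i.2) = 0 by [].
  rewrite (height_Cons (tgraph i.1.1)) (height_Cons (tgraph i.1.2)) h3.
  by move: tp; rewrite -/(n i); lia.
have Bn : pbounded exchange_dom n n by apply: pbounded_sz.
have BB : pbounded exchange_dom n B.
  by apply: pboundedD (pbounded_const _ _ _); apply: pboundedD => //;
     apply: pboundedM.
apply: pboundedD; last exact: pbounded_horner.
by apply: pboundedD (pbounded_const _ _ _); apply: pboundedD.
Qed.

(** Incremental polynomial time allows a search to be polynomial in the number of vertices and of
    graphs already found. *)
Definition gsz (i : graph * seq graph) := (nverts i.1 + size i.2)%N.
Definition gdom (i : graph * seq graph) := all_max P i.1 i.2.

Lemma gsz_nverts (D : graph * seq graph -> Prop) :
  pbounded D gsz (fun i => nverts i.1).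
Proof. by apply: pbounded_le (pbounded_sz _ _) => i _; apply: leq_addr. Qed.

Lemma gsz_size (D : graph * seq graph -> Prop) :
  pbounded D gsz (fun i => size i.2).
Proof. by apply: pbounded_le (pbounded_sz _ _) => i _; apply: leq_addl. Qed.

Definition exchanges (G X : graph) : seq graph :=
  flatten [seq exchange io G X v | v <- vseq G].

Definition exchanges_dom (i : graph * graph) := isub i.2 i.1 /\ P i.2.

Lemma size_exchanges :
  pbounded exchanges_dom (fun i => nverts i.1)
    (fun i => size (exchanges i.1 i.2)).
Proof.
have [p Hp] := size_exchange.
apply: (pbounded_le (g := fun i => (nverts i.1 * p.[nverts i.1]%R)%N)).
  move=> i [XG PX]; rewrite -size_vseq; apply: size_flatten_le => v.
  by rewrite mem_vseq size_vseq => vG; apply: (Hp (i.1, i.2, v)).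
by apply: pboundedM; [|apply: pbounded_horner]; apply: pbounded_sz.
Qed.

Lemma pcomp_exchanges :
  pcomp exchanges_dom (fun i => nverts i.1)
    (fun i => Cons (tgraph i.1) (tgraph i.2))
    (fun i => tgraphs (exchanges i.1 i.2)).
Proof.
apply: (@pcomp_comp _ _ _ (fun i =>
  Cons (Cons (tgraph i.1) (tgraph i.2)) (tlist (map Atom (vseq i.1))))).
  by apply: (@pcomp_expr _ _ _ (ECons (EVar 0) (EHd (EHd (EVar 0))))).
have dom (j : graph * graph * nat) :
    exchanges_dom j.1 /\ j.2 \in vseq j.1.1 -> exchange_dom j.
  by move=> [[XG PX]]; rewrite mem_vseq.
apply: pcomp_flatmap.
- by apply: pbounded_le (pbounded_sz _ _) => i _; rewrite size_vseq.
- exact: (pbounded_map dom size_exchange).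
- apply: (@pcomp_call _ _ _ _ _ _ _ _ (ECons (EHd (EHd (EVar 0)))
    (ECons (ETl (EHd (EVar 0))) (ETl (EVar 0)))) id _ _ pcomp_exchange) => //.
  exact: pbounded_sz.
Qed.

Lemma pcomp_seeds :
  pcomp (fun=> True) nverts tgraph (fun G => tgraphs (seeds Pb G)).
Proof.
apply: (@pcomp_comp _ _ _ (fun G => Cons Nil
  (tgraphs [:: induced G [::]; induced G (root_seq G)]))).
  apply: pcomp_pair; first by apply: (@pcomp_expr _ _ _ ENil).
  apply: pcomp_pair.
    apply: (@pcomp_call _ _ _ _ _ _ _ _ (ECons (EVar 0) ENil)
      (fun G => (G, [::])) _ _ pcomp_induced) => //=.
    by apply: pbounded_le (pbounded_sz _ _) => G _; rewrite addn0.
  apply: pcomp_pair; last by apply: (@pcomp_expr _ _ _ ENil).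
  apply: (@pcomp_comp _ _ _ (fun G =>
    Cons (tgraph G) (tlist (map Atom (root_seq G))))).
    apply: pcomp_pair; first exact: pcomp_id.
    apply: (@pcomp_if _ _ _ _ _
      (fun G => if groot G is Some r then Atom r else Nil)).
    + by apply: (@pcomp_expr _ _ _ (ETl (ETl (EVar 0)))).
    + apply: (@pcomp_expr _ _ _ (ECons (ETl (ETl (EVar 0))) ENil)) => G [_] /=.
      by rewrite /root_seq; case: (groot G).
    + apply: (@pcomp_expr _ _ _ ENil) => G [_] /=.
      by rewrite /root_seq; case: (groot G).
  apply: (@pcomp_call _ _ _ _ _ _ _ _ (EVar 0)
    (fun G => (G, root_seq G)) _ _ pcomp_induced) => //.
  apply: (pbounded_le (g := fun G => (nverts G + 1)%N)).
    by move=> G _; rewrite /root_seq leq_add2l; case: (groot G).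
  by apply: pboundedD; [apply: pbounded_sz | apply: pbounded_const].
apply: (pcomp_filter (env := fun=> Nil) (p := fun=> Pb)
  (l := fun G => [:: induced G [::]; induced G (root_seq G)])).
  exact: (pbounded_const _ _ 2).
apply: (@pcomp_call _ _ _ _ _ _ _ _ (ETl (EVar 0)) (fun j => j.2) _ _ comp_Pb) => //.
apply: pbounded_le (pbounded_sz _ _) => -[G H] [_] /=.
by rewrite !inE => /orP[]/eqP->; apply/isub_nverts/isub_induced.
Qed.

Lemma gdom_exchanges (j : graph * seq graph * graph) :
  gdom j.1 /\ j.2 \in j.1.2 -> exchanges_dom (j.1.1, j.2).
Proof. by move=> [GN jN]; have [[]] := GN _ jN. Qed.

Lemma gsz_exchanges :
  pbounded (fun j : graph * seq graph * graph => gdom j.1 /\ j.2 \in j.1.2)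
    (fun j => gsz j.1) (fun j => size (exchanges j.1.1 j.2)).
Proof.
have [p Hp] := size_exchanges; exists p => j Dj.
apply: leq_trans (Hp _ (gdom_exchanges Dj)) _.
exact/leq_horner/leq_addr.
Qed.

Lemma size_starts : pbounded gdom gsz (fun i => size (starts Pb io i.1 i.2)).
Proof.
have [p Hp] := gsz_exchanges.
apply: (pbounded_le (g := fun i => (2 + size i.2 * p.[gsz i]%R)%N)).
  move=> i Di; rewrite size_cat; apply: leq_add.
    by rewrite size_filter; apply: leq_trans (count_size _ _) _.
  by apply: size_flatten_le => X XN; apply: (Hp (i, X)).
apply: pboundedD; first exact: pbounded_const.
by apply: pboundedM (gsz_size _) _; apply/pbounded_horner/pbounded_sz.
Qed.

Lemma pcomp_starts :
  pcomp gdom gsz (fun i => Cons (tgraph i.1) (tgraphs i.2))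
    (fun i => tgraphs (starts Pb io i.1 i.2)).
Proof.
apply: pcomp_cat.
- apply: (pbounded_le (g := fun=> 2)); last exact: pbounded_const.
  by move=> i _; rewrite size_filter; apply: leq_trans (count_size _ _) _.
- apply: pbounded_le size_starts => i _.
  by rewrite size_cat; apply: leq_addl.
- apply: (@pcomp_call _ _ _ _ _ _ _ _ (EHd (EVar 0)) fst _ _ pcomp_seeds) => //.
  exact: gsz_nverts.
- apply: (pcomp_flatmap (env := fun i => tgraph i.1)
    (g := fun i => exchanges i.1)); first exact: gsz_size.
    exact: gsz_exchanges.
  apply: (@pcomp_call _ _ _ _ _ _ _ _ (EVar 0)
    (fun j => (j.1.1, j.2)) _ _ pcomp_exchanges) => //.
    exact: gdom_exchanges.
  by apply: (pbounded_map (D := fun=> True) (h := fst) _ (gsz_nverts _)).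
Qed.

Lemma pcomp_subverts :
  pcomp (fun=> True) (fun i : graph * graph => (nverts i.1 + nverts i.2)%N)
    (fun i => Cons (tgraph i.1) (tgraph i.2))
    (fun i => tbool (verts i.1 `<=` verts i.2)).
Proof.
apply: (@pcomp_eqr _ _ _ _
  (fun i => tbool (~~ has (fun v => v \notin vseq i.2) (vseq i.1)))).
  move=> i _; congr tbool; rewrite -all_predC; apply/allP/fsubsetP => sub v.
    by rewrite -mem_vseq => /sub; rewrite /= negbK mem_vseq.
  by rewrite mem_vseq /= negbK mem_vseq; apply: sub.
apply: pcomp_not; apply: (@pcomp_comp _ _ _ (fun i =>
  Cons (tlist (map Atom (vseq i.2))) (tlist (map Atom (vseq i.1))))).
  by apply: (@pcomp_expr _ _ _
    (ECons (EHd (ETl (EVar 0))) (EHd (EHd (EVar 0))))).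
apply: (pcomp_has (env := fun i => tlist (map Atom (vseq i.2)))
  (p := fun i v => v \notin vseq i.2)).
  by apply: pbounded_le (pbounded_sz _ _) => i _; rewrite size_vseq leq_addr.
apply: pcomp_not; apply: (@pcomp_call _ _ _ _ _ _ _ _
  (ECons (ETl (EVar 0)) (EHd (EVar 0))) (fun j => (j.2, vseq j.1.2)) _ _
  pcomp_mem) => //.
by apply: pbounded_le (pbounded_sz _ _) => j _; rewrite size_vseq leq_addl.
Qed.

Lemma pcomp_fresh :
  pcomp gdom gsz (fun i => Cons (tgraph i.1) (tgraphs i.2))
    (fun i => tgraphs (fresh Pb io i.1 i.2)).
Proof.
have isub_cand (i : graph * seq graph) K : gdom i ->
    K \in map (extend Pb i.1) (starts Pb io i.1 i.2) -> isub K i.1.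
  move=> Di /mapP[S' SN ->]; have [SG PS] := starts_psub PbP ioP Di SN.
  by have [] := extend_above PbP SG PS.
apply: (@pcomp_comp _ _ _ (fun i => Cons (tgraphs i.2)
  (tgraphs (map (extend Pb i.1) (starts Pb io i.1 i.2))))).
  apply: pcomp_pair; first by apply: (@pcomp_expr _ _ _ (ETl (EVar 0))).
  apply: (@pcomp_comp _ _ _ (fun i => Cons (tgraph i.1)
    (tgraphs (starts Pb io i.1 i.2)))).
    apply: pcomp_pair pcomp_starts.
    by apply: (@pcomp_expr _ _ _ (EHd (EVar 0))).
  apply: (@pcomp_eqr _ _ _ _ (fun i => tgraphs (flatten
    (map (fun H => [:: extend Pb i.1 H]) (starts Pb io i.1 i.2))))).
    by move=> i _; congr tgraphs; elim: (starts _ _ _ _) => //= H s ->.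
  apply: (pcomp_flatmap (env := fun i => tgraph i.1)
    (g := fun i H => [:: extend Pb i.1 H])); first exact: size_starts.
    exact: (pbounded_const _ _ 1).
  apply: pcomp_pair; last by apply: (@pcomp_expr _ _ _ ENil).
  apply: (@pcomp_call _ _ _ _ _ _ _ _ (EVar 0)
    (fun j => (j.1.1, j.2)) _ _ pcomp_extend) => //.
    by move=> j [Dj jS]; have [] := starts_psub PbP ioP Dj jS.
  by apply: (pbounded_map (D := fun=> True) (h := fst) _ (gsz_nverts _)).
apply: (pcomp_filter (env := fun i => tgraphs i.2)
  (p := fun i K => ~~ covered i.2 K)).
  by apply: pbounded_le size_starts => i _; rewrite size_map.
apply: pcomp_not.
apply: (@pcomp_comp _ _ _ (fun j => Cons (tgraph j.2) (tgraphs j.1.2))).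
  by apply: (@pcomp_expr _ _ _ (ECons (ETl (EVar 0)) (EHd (EVar 0)))).
apply: (pcomp_has (env := fun j => tgraph j.2)
  (p := fun j X => verts j.2 `<=` verts X)).
  by apply: (pbounded_map (D := fun=> True) (h := fst) _ (gsz_size _)).
apply: (@pcomp_call _ _ _ _ _ _ _ _ (EVar 0)
  (fun j => (j.1.2, j.2)) _ _ pcomp_subverts) => //=.
(* Both the candidate and the graph it is compared with are induced subgraphs of the input graph. *)
apply: (pbounded_le (g := fun j => (gsz j.1.1 + gsz j.1.1)%N)); last first.
  by apply: pboundedD; apply: pbounded_sz.
move=> [[i K] X] [[/= Di KS] XN]; apply: leq_add.
  by apply: leq_trans (isub_nverts (isub_cand _ _ Di KS)) (leq_addr _ _).
by have [[/isub_nverts XG _] _] := Di X XN; apply: leq_trans XG (leq_addr _ _).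
Qed.

End ComputeExchange.

(** * Enumeration *)

(** This exponential bound only shows that the enumeration halts; it does not enter the time
    bounds. *)
Lemma size_all_max P G N : uniq N -> all_max P G N ->
  size N <= #|` fpowerset (verts G)|.
Proof.
move=> uN NG; rewrite -(size_map (fun D : {fset nat} => induced G D)).
apply: uniq_leq_size uN _ => X XN; have [[XG _] _] := NG X XN.
apply/mapP; exists (verts X); first by rewrite fpowersetE isub_verts.
by rewrite {1}(isubE XG); apply: induced_eq => v _; rewrite mem_vseq.
Qed.

Local Close Scope fset_scope.

(** Used with the halting time as default: delaying a run shifts the output times and the halting
    time alike, so reading beyond the last output is covered too. *)
Lemma nth_map_default T U (f : T -> U) d s k :
  nth (f d) (map f s) k = f (nth d s k).
Proof. by elim: s k => [|a s IH] [|k] /=. Qed.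

Section Enumeration.

Variables (P : graph -> Prop) (fresh : graph -> seq graph -> seq graph).
Hypothesis fresh_max : forall G N K, all_max P G N -> K \in fresh G N ->
  max_psubgraph P G K /\ K \notin N.
Hypothesis fresh_complete : forall G N, all_max P G N -> fresh G N = [::] ->
  forall Y, max_psubgraph P G Y -> Y \in N.
Hypothesis comp_fresh :
  pcomp (gdom P) gsz (fun i => Cons (tgraph i.1) (tgraphs i.2))
    (fun i => tgraphs (fresh i.1 i.2)).

Lemma all_max_cons G N K Ks : uniq N -> all_max P G N -> fresh G N = K :: Ks ->
  uniq (K :: N) /\ all_max P G (K :: N).
Proof.
move=> uN NG fN; have [] := @fresh_max G N K NG; first by rewrite fN mem_head.
move=> mK KN; rewrite /= KN uN; split=> // X.
by rewrite inE => /orP[/eqP->|/NG].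
Qed.

Fixpoint found (k : nat) (G : graph) : seq graph :=
  if k is k'.+1 then
    let N := found k' G in if fresh G N is K :: _ then K :: N else N
  else [::].

Lemma foundP k G :
  [/\ uniq (found k G), all_max P G (found k G) &
      size (found k G) = k \/ size (found k G) < k /\ fresh G (found k G) = [::]].
Proof.
elim: k => [|k [uN NG sz]] /=; first by split=> //; left.
case E: (fresh G (found k G)) => [|K Ks].
  by split=> //; right; split=> //; case: sz => [->|[/ltnW]].
have [uK KG] := all_max_cons uN NG E; split=> //.
by case: sz => [sz|[_]]; [left; rewrite /= sz | rewrite E].
Qed.

(** As [k] is a constant, the rounds are written one after another in the program, and the
    polynomial may depend on [k]. *)
Lemma pcomp_found k :
  pcomp (fun=> True) nverts tgraph (fun G => tgraphs (found k G)).
Proof.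
elim: k => [|k IH] /=; first by apply: (@pcomp_expr _ _ _ ENil).
apply: (pcomp_let IH).
apply: (@pcomp_let _ _ _ (fun G => tgraphs (fresh G (found k G)))).
  apply: (@pcomp_call _ _ _ _ _ _ _ _ (EVar 0)
    (fun G => (G, found k G)) _ _ comp_fresh) => //.
    by move=> G _; have [] := foundP k G.
  apply: (pbounded_le (g := fun G => (nverts G + k)%N)).
    move=> G _; rewrite /gsz leq_add2l.
    by have [_ _ [->|[/ltnW]]] := foundP k G.
  by apply: pboundedD; [apply: pbounded_sz | apply: pbounded_const].
apply: (@pcomp_if _ _ _ _ _ (fun G => tgraphs (fresh G (found k G)))).
- by apply: (@pcomp_expr _ _ _ (ETl (EVar 0))).
- apply: (@pcomp_expr _ _ _ (ECons (EHd (ETl (EVar 0))) (ETl (EHd (EVar 0))))).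
  by move=> G [_] /=; case: (fresh _ _).
- apply: (@pcomp_expr _ _ _ (ETl (EHd (EVar 0)))).
  by move=> G [_] /=; case: (fresh _ _).
Qed.

Lemma k_solvable k : k_max_psubgraphs_poly P k.
Proof.
have [c [p Hc]] := pcomp_found k; exists c, p => G.
have [t R tp] := Hc G Logic.I; have [uN NG sz] := foundP k G.
exists (found k G), t; split=> //; case: sz => [->|[lt_k fN]]; first by left.
right; split=> //; split=> // H; split; first exact: NG.
exact: fresh_complete.
Qed.

(** Variable 0 holds the graph, 1 the graphs found so far and 2 the fresh ones. A graph is emitted
    before the next search starts. *)
Definition enum_loop (c : cmd) : cmd :=
  While (EVar 2)
    (Seq (Emit (EHd (EVar 2)))
    (Seq (Assign 1 (ECons (EHd (EVar 2)) (EVar 1)))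
         (Call 2 c (ECons (EVar 0) (EVar 1))))).

Definition enum_cmd (c : cmd) : cmd :=
  Seq (Assign 1 ENil)
 (Seq (Call 2 c (ECons (EVar 0) (EVar 1))) (enum_loop c)).

Section Loop.

Variables (c : cmd) (q : {poly nat}) (G : graph).
Hypothesis c_fresh : forall N, all_max P G N -> exists2 t,
  returns c (Cons (tgraph G) (tgraphs N)) (tgraphs (fresh G N)) t &
  t <= q.[(nverts G + size N)%N]%R.

(** Output [k], or the halt if there is none, is preceded by at most [k] searches, on lists of at
    most [size N + k] graphs; [q] is monotone. The number [m] is a termination measure. *)
Lemma exec_enum_loop m N s :
  uniq N -> all_max P G N -> #|` fpowerset (verts G)|%fset - size N <= m ->
  s 0 = tgraph G -> s 1 = tgraphs N -> s 2 = tgraphs (fresh G N) ->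
  exists Ms t o s',
    [/\ exec (enum_loop c) s t o s',
        [seq x.2 | x <- o] = [seq tgraph H | H <- Ms],
        lists (Ms ++ N) (max_psubgraph P G)
      & forall k, nth t [seq x.1 | x <- o] k <=
          k.+1 * (14 + q.[(nverts G + size N + k.+1)%N]%R)].
Proof.
elim: m N s => [|m IH] N s uN NG lem s0 s1 s2; case E: (fresh G N) => [|K Ks].
- exists [::], 2, [::], s; split=> //.
  + by apply: (@exec_while_false (EVar 2)); rewrite /= s2 E.
  + by split=> // H; split; [apply: NG | apply: fresh_complete].
  + by move=> k; rewrite nth_nil mulSn; lia.
(* [N] already has as many members as [G] has sets of vertices, which leaves no room for [K]. *)
- have [uK KG] := all_max_cons uN NG E.
  have := size_all_max uK KG; rewrite [size (K :: N)]/=.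
  move: lem; rewrite leqn0 subn_eq0 => lem ltN.
  by have := leq_trans ltN lem; rewrite ltnn.
- exists [::], 2, [::], s; split=> //.
  + by apply: (@exec_while_false (EVar 2)); rewrite /= s2 E.
  + by split=> // H; split; [apply: NG | apply: fresh_complete].
  + by move=> k; rewrite nth_nil mulSn; lia.
have [uK KG] := all_max_cons uN NG E; have [tc Rc Bc] := c_fresh KG.
pose s3 := upd s 1 (tgraphs (K :: N)).
pose s4 := upd s3 2 (tgraphs (fresh G (K :: N))).
have [|Ms [t [o [s' [E' oE LMs tk]]]]] := IH (K :: N) s4 uK KG _ s0 erefl erefl.
  by move: lem => /=; lia.
(* The test takes 2 steps, the emission 3, the assignment 5 and passing the argument 4, so a round
   costs [14 + tc] and its output appears at time 5. *)
exists (K :: Ms), (2 + ((3 + (5 + (4 + tc))) + t)),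
  ((5, tgraph K) :: delay (14 + tc) o), s'; split.
- have -> : (5, tgraph K) :: delay (14 + tc) o =
      delay 2 (([:: (3, tgraph K)] ++ delay 3 [::]) ++
        delay (3 + (5 + (4 + tc))) o).
    rewrite /delay /=; congr (_ :: _); rewrite -map_comp; apply: eq_map => x /=.
    by congr (_, _); lia.
  apply: (@exec_while_true (EVar 2)); first by rewrite /= s2 E.
  apply: exec_seq E'; apply: exec_seq.
    have -> : tgraph K = eval s (EHd (EVar 2)) by rewrite /= s2 E.
    exact: exec_emit.
  apply: (run_seq (s2 := s3)).
    have -> : s3 = upd s 1 (eval s (ECons (EHd (EVar 2)) (EVar 1))).
      by rewrite /s3 /= s2 s1 E.
    exact: exec_assign.
  apply: (@run_call _ _ (ECons (EVar 0) (EVar 1))).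
  by rewrite /= /s3 /upd /= s0; apply: Rc.
- rewrite /= /delay -map_comp /= -oE; congr (_ :: _).
- case: LMs => uMs LMs; have pe : perm_eq (K :: Ms ++ N) (Ms ++ K :: N).
    by rewrite -cat1s -[K :: N]cat1s perm_catCA.
  by split; [rewrite (perm_uniq pe) | move=> H; rewrite (perm_mem pe)].
- case=> [|k]; first by rewrite /=; lia.
  rewrite /= /delay -map_comp.
  rewrite (eq_map (g := fun x : nat * tree => 14 + tc + x.1)%N) //.
  rewrite (map_comp (fun x => 14 + tc + x)%N fst).
  have -> : (2 + (3 + (5 + (4 + tc)) + t) = 14 + tc + t)%N by lia.
  rewrite (nth_map_default (fun x => 14 + tc + x)%N) [k.+2 * _]mulSn.
  apply: leq_add.
    rewrite leq_add2l; apply: leq_trans Bc _; apply: leq_horner => /=; lia.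
  have -> : (nverts G + size N + k.+2 = nverts G + size (K :: N) + k.+1)%N.
    by rewrite /=; lia.
  exact: tk.
Qed.

End Loop.

Lemma incremental_solvable : incremental_poly_solvable P.
Proof.
have [c [q Hc]] := comp_fresh.
(* Start-up, with its initial search, costs at most one further round. Output [k] thus comes within
   [k.+2] rounds, and [k.+2] is at most the value of ['X + 1] at [nverts G + k.+1]. *)
exists (enum_cmd c), (('X + 1) * (14%:P + q))%R => G.
have c_fresh N : all_max P G N -> exists2 t,
    returns c (Cons (tgraph G) (tgraphs N)) (tgraphs (fresh G N)) t &
    t <= q.[(nverts G + size N)%N]%R by move=> NG; apply: (Hc (G, N)).
have NG : all_max P G [::] by [].
have [t0 R0 B0] := c_fresh _ NG.
pose s1 := upd (init (tgraph G)) 1 Nil.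
pose s2 := upd s1 2 (tgraphs (fresh G [::])).
have [Ms [t [o [s' [E oE LMs tk]]]]] := exec_enum_loop c_fresh
  (s := s2) (N := [::]) isT NG (leqnn _) erefl erefl erefl.
exists Ms, (2 + ((4 + t0) + t)), (delay (6 + t0) o), s'; split.
- have -> : delay (6 + t0) o = [::] ++ delay 2 ([::] ++ delay (4 + t0) o).
    rewrite /delay /= -map_comp; apply: eq_map => x /=.
    by congr (_, _); lia.
  apply: exec_seq; first exact: (@exec_assign _ ENil).
  apply: exec_seq E.
  exact: (@run_call _ _ (ECons (EVar 0) (EVar 1))).
- by rewrite -oE /delay -map_comp; apply: eq_map.
- by move: LMs; rewrite cats0.
- move=> k; rewrite /delay -map_comp.
  rewrite (eq_map (g := fun x : nat * tree => 6 + t0 + x.1)%N) //.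
  rewrite (map_comp (fun x => 6 + t0 + x)%N fst).
  have -> : (2 + (4 + t0 + t) = 6 + t0 + t)%N by lia.
  rewrite (nth_map_default (fun x => 6 + t0 + x)%N).
  rewrite hornerM !hornerD hornerX !hornerC.
  set Q := (14 + q.[(nverts G + k.+1)%N])%R.
  have tQ := tk k; rewrite addn0 -/Q in tQ.
  have t0Q : 6 + t0 <= Q.
    rewrite -[Q]/(14 + _)%N; apply: leq_add => //; apply: leq_trans B0 _.
    by apply: leq_horner => /=; lia.
  apply: leq_trans (leq_add t0Q tQ) _; rewrite -mulSn.
  apply: leq_mul => //; rewrite -[X in _ <= X]/(_ + 1)%N; lia.
Qed.

End Enumeration.

Theorem theorem7p2 (P : graph -> Prop)
  (P_nonempty : exists G, P G)
  (P_decidable : poly_decidable P)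
  (P_hereditary :
    hereditary P \/ connected_hereditary P \/ rooted_hereditary P)
  (P_io : io_restricted_poly_solvable P) :
  incremental_poly_solvable P /\ (forall k : nat, k_max_psubgraphs_poly P k).
Proof.
have accP : strongly_accessible P.
  case: P_hereditary => [|[]].
  - exact: hereditary_accessible.
  - exact: connected_hereditary_accessible.
  - exact: rooted_hereditary_accessible.
have [cd [pd Hd]] := P_decidable; have [ci [pi Hi]] := P_io.
(* The hypotheses only assert that each input has a correct answer computed in time. Choice turns
   these answers into functions, so that [pcomp] applies; the programs remain [cd] and [ci]. *)
pose Pb G := epsilon (inhabits true) (fun b => exists t,
  [/\ returns cd (tgraph G) (tbool b) t, t <= pd.[nverts G]%R & b <-> P G]).
have PbP G : exists t, [/\ returns cd (tgraph G) (tbool (Pb G)) t,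
    t <= pd.[nverts G]%R & Pb G <-> P G].
  exact: epsilon_spec (inhabits true) _ (Hd G).
pose io G v := epsilon (inhabits [::]) (fun Hs => exists t,
  [/\ returns ci (Cons (tgraph G) (Atom v)) (tgraphs Hs) t,
      t <= pi.[nverts G]%R & lists Hs (max_psubgraph_at P G v)]).
have ioP G v : almost_satisfies P G -> v \in verts G -> exists t,
    [/\ returns ci (Cons (tgraph G) (Atom v)) (tgraphs (io G v)) t,
        t <= pi.[nverts G]%R & lists (io G v) (max_psubgraph_at P G v)].
  by move=> aG vG; apply: epsilon_spec (inhabits [::]) _ (Hi G v aG vG).
have PbE G : Pb G <-> P G by have [t []] := PbP G.
have ioE G v : almost_satisfies P G -> v \in verts G ->
    lists (io G v) (max_psubgraph_at P G v).
  by move=> aG vG; have [t []] := ioP G v aG vG.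
have comp_Pb : pcomp (fun=> True) nverts tgraph (fun G => tbool (Pb G)).
  by exists cd, pd => G _; have [t [R B _]] := PbP G; exists t.
have comp_io : pcomp
    (fun Gv : graph * nat => almost_satisfies P Gv.1 /\ Gv.2 \in verts Gv.1)
    (fun Gv => nverts Gv.1) (fun Gv => Cons (tgraph Gv.1) (Atom Gv.2))
    (fun Gv => tgraphs (io Gv.1 Gv.2)).
  exists ci, pi => -[G v] [aG vG].
  by have [t [R B _]] := ioP G v aG vG; exists t.
have fmax := fresh_max PbE accP ioE.
have fcomplete := fresh_complete PbE accP P_hereditary ioE.
have fcomp := pcomp_fresh PbE ioE comp_Pb comp_io.
split; first exact: incremental_solvable fmax fcomplete fcomp.
by move=> k; apply: k_solvable fmax fcomplete fcomp k.
Qed.
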